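(* For every MCFTG $G$ with terminal alphabet $\Sigma$ and $\theta(G)\ge2$ there is an $\mathrm{LDT}^{\mathrm R}$-equivalent monadic MCFTG $G'$ (i.e. $\theta(G')\le1$) such that $\mu(G')\le\mu(G)\cdot|\Sigma|\cdot\mathrm{mr}_\Sigma^2\cdot(2\cdot\theta(G)-1)$. Moreover, if $\Delta\subseteq\Sigma^{(0)}$ and $G$ is $\Delta$-lexicalized, then $G'$ is $\Delta$-lexicalized.
   Context: **Sequences and trees.** $\mathbb N_0$ is the set of nonnegative integers, $[n]=\{1,\dots,n\}$. $A^*$ (resp. $A^+$) is the set of finite (resp. nonempty finite) sequences over $A$; a sequence of length 1 is identified with its element; juxtaposition is concatenation; $\mathrm{occ}(w)$ is the set of elements occurring in the sequence $w$; $w$ is repetition-free if no element occurs twice in it. A ranked alphabet is a set $\Sigma$ with a rank map $\mathrm{rk}\colon\Sigma\to\mathbb N_0$ (applied elementwise to sequences); $\Sigma^{(k)}$ is the set of symbols of rank $k$; for finite $\Sigma$, $\mathrm{mr}_\Sigma$ is the maximal rank of its symbols. $T_\Sigma$ is the set of trees over $\Sigma$: the smallest set of strings over $\Sigma$ containing $\sigma t_1\cdots t_k$ (also written $\sigma(t_1,\dots,t_k)$) for all $\sigma\in\Sigma^{(k)}$ and $t_i\in T_\Sigma$. A forest is a finite sequence of trees. $X=\{x_1,x_2,\dots\}$ is a set of variables (of rank 0, disjoint from other alphabets), $X_k=\{x_1,\dots,x_k\}$. A pattern of rank $k$ over $\Sigma$ is a tree over $\Sigma\cup X_k$ in which each of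 $x_1,\dots,x_k$ occurs exactly once; $P_\Sigma(X_k)$ is the set of these and $P_\Sigma(X)=\bigcup_k P_\Sigma(X_k)$. For a forest $t$, $\mathrm{occ}_\Omega(t)$ is the set of symbols of $\Omega$ occurring in $t$; $t$ is uniquely $\Omega$-labeled if each symbol of $\Omega$ occurs at most once in $t$. **Substitution.** For a repetition-free sequence of symbols $\sigma=(\sigma_1,\dots,\sigma_n)$ and patterns $u=(u_1,\dots,u_n)$ with $\mathrm{rk}(u)=\mathrm{rk}(\sigma)$, $t[\sigma\gets u]$ is obtained from $t$ by replacing, recursively, each subtree $\sigma_i(s_1,\dots,s_k)$ by $u_i$ in which $x_j$ is replaced by the transformed $s_j$ (componentwise on forests). For $\mathcal L=\{B_1,\dots,B_k\}$ with $B_1\cdots B_k$ repetition-free and forests $f(B_i)$ with $\mathrm{rk}(f(B_i))=\mathrm{rk}(B_i)$, $t[B\gets f(B)\mid B\in\mathcal L]$ means $t[B_1\cdots B_k\gets f(B_1)\cdots f(B_k)]$. **MCFTG.** A multiple context-free tree grammar (MCFTG) is $G=(N,\mathcal N,\Sigma,S,R)$ where $N$ is a finite ranked alphabet of nonterminals; $\mathcal N\subseteq N^+$ is a finite set of repetition-free sequences (big nonterminals) with $\mathrm{occ}(A)\ne\mathrm{occ}(A')$ for distinct $A,A'\in\mathcal N$; $\Sigma$ is a finite ranked alphabet of terminals, disjoint from $N$, with $\mathrm{mr}_\Sigma\ge1$; $S\in\mathcal N\cap N^{(0)}$ is the initial nonterminal; $R$ is a finite set of rules $A\to(u,\mathcal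 L)$ with $A\in\mathcal N$, $u\in P_{N\cup\Sigma}(X)^+$ a uniquely $N$-labeled forest with $\mathrm{rk}(u)=\mathrm{rk}(A)$, and $\mathcal L\subseteq\mathcal N$ (the links) such that the sets $\mathrm{occ}(B)$, $B\in\mathcal L$, are pairwise disjoint with union $\mathrm{occ}_N(u)$. The sets $L(G,A)$, $A\in\mathcal N$, are simultaneously the smallest sets of forests such that for every rule $A\to(u,\mathcal L)$ and all $f(B)\in L(G,B)$ ($B\in\mathcal L$), $u[B\gets f(B)\mid B\in\mathcal L]\in L(G,A)$. $L(G)=L(G,S)\subseteq T_\Sigma$. The multiplicity is $\mu(G)=\max\{|A|: A\in\mathcal N\}$; the width is $\theta(G)=\max\{\mathrm{rk}(C): C\in N\}$. Convention: every MCFTG is start-separated, i.e. $S$ does not occur in right-hand sides of rules. **Derivation trees.** For every rule fix a linear order on its links; a rule with $k$ links has rank $k$, so $R$ is a ranked alphabet. The sets $L(G_{\mathrm{der}},A)\subseteq T_R$ are the smallest sets such that $\rho(d_1,\dots,d_k)\in L(G_{\mathrm{der}},A)$ whenever $\rho=A\to(u,\{B_1,\dots,B_k\})\in R$ (links in their order) and $d_i\in L(G_{\mathrm{der}},B_i)$; and $\mathrm{val}(\rho(d_1,\dots,d_k))=u[B_i\gets\mathrm{val}(d_i)\mid 1\le i\le k]$. $L(G_{\mathrm{der}})=L(G_{\mathrm{der}},S)$. **$\mathrm{LDT}^{\mathrm R}$-equivalence.** A linear deterministic top-down tree transducer with regular look-ahead ($\mathrm{LDT}^{\mathrm R}$-transducer)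 from $\Omega$ to $\Sigma$ has a finite state set $Q$, an initial state $q_0$, and finitely many rules $\langle q,\omega(y_1{:}L_1,\dots,y_k{:}L_k){:}L_0\rangle\to\zeta$ with $q\in Q$, $\omega\in\Omega^{(k)}$, $L_0,\dots,L_k$ regular tree languages over $\Omega$, and $\zeta$ a tree over $\Sigma$ and rank-0 symbols $\langle q',y_i\rangle$ ($q'\in Q$, $i\in[k]$) in which each $y_i$ occurs at most once; for two distinct rules with the same $q,\omega$ and look-ahead languages $L_i$, $L_i'$ there is $0\le i\le k$ with $L_i\cap L_i'=\emptyset$. For $s=\omega(s_1,\dots,s_k)$, $M_q(s)=\zeta[\langle q',y_i\rangle\gets M_{q'}(s_i)]$ if there is a rule $\langle q,\omega(y_1{:}L_1,\dots,y_k{:}L_k){:}L_0\rangle\to\zeta$ with $s\in L_0$, $s_i\in L_i$ for all $i\in[k]$ (undefined if there is no such rule or some needed $M_{q'}(s_i)$ is undefined); it realizes the partial function $M=M_{q_0}\colon T_\Omega\to T_\Sigma$. MCFTGs $G,G'$ with the same terminal alphabet and rule sets $R,R'$ are $\mathrm{LDT}^{\mathrm R}$-equivalent if there are such transductions $M\colon T_R\to T_{R'}$, $M'\colon T_{R'}\to T_R$ with $M(d)\in L(G'_{\mathrm{der}})$ and $\mathrm{val}(M(d))=\mathrm{val}(d)$ for all $d\in L(G_{\mathrm{der}})$, and $M'(d')\in L(G_{\mathrm{der}})$ and $\mathrm{val}(M'(d'))=\mathrm{val}(d')$ for all $d'\in L(G'_{\mathrm{der}})$ (so $L(G)=L(G')$).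 **Lexicalization.** A rule $A\to(u,\mathcal L)$ is initial if $A=S$, terminal if $\mathcal L=\emptyset$, proper if it is not both initial and terminal, and $\Delta$-lexicalized if some symbol of $\Delta$ occurs in $u$. $G$ is $\Delta$-lexicalized if all its proper rules are. *)

(* Defs.v *)
From mathcomp Require Import all_boot.

Set Implicit Arguments.
Unset Strict Implicit.
Unset Printing Implicit Defensive.

Record ralph := RAlph { rsym :> finType; rk : rsym -> nat }.

Definition mr (Omega : ralph) : nat := \max_(a : Omega) rk a.

(* Trees are unranked at the level of types; T_Omega is carved out by [ranked]. *)
Inductive tree (A : Type) := Node of A & seq (tree A).

Section Trees.
Variables A B : Type.

Fixpoint ranked (r : A -> nat) (t : tree A) : bool :=
  let: Node a ts := t in (size ts == r a) && all (ranked r) ts.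

Fixpoint labels (t : tree A) : seq A :=
  let: Node a ts := t in a :: flatten [seq labels s | s <- ts].

Fixpoint tmap (f : A -> B) (t : tree A) : tree B :=
  let: Node a ts := t in Node (f a) [seq tmap f s | s <- ts].

End Trees.

(* Tags make nonterminals, terminals and variables disjoint.
   Variables are numbered from 0: [Var i] is x_(i+1). *)
Inductive sym (N Sigma : Type) := Nt of N | Tm of Sigma | Var of nat.
Arguments Nt {N Sigma} _.
Arguments Tm {N Sigma} _.
Arguments Var {N Sigma} _.

Section Patterns.
Variables N Sigma : ralph.

Definition stree := tree (sym N Sigma).

Definition sym_rk (s : sym N Sigma) : nat :=
  match s with Nt n => rk n | Tm a => rk a | Var _ => 0 end.

Definition nts (u : seq stree) : seq N :=
  pmap (fun s => if s is Nt n then Some n else None)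
       (flatten [seq labels t | t <- u]).

Definition tms (u : seq stree) : seq Sigma :=
  pmap (fun s => if s is Tm a then Some a else None)
       (flatten [seq labels t | t <- u]).

Definition vars (t : stree) : seq nat :=
  pmap (fun s => if s is Var i then Some i else None) (labels t).

Definition pattern (k : nat) (t : stree) : bool :=
  ranked sym_rk t && perm_eq (vars t) (iota 0 k).

Fixpoint vsubst (ss : seq stree) (t : stree) : stree :=
  let: Node s ts := t in
  if s is Var i then nth t ss i else Node s [seq vsubst ss t' | t' <- ts].

(* t[sigma <- u] *)
Fixpoint subst (sigma : seq N) (u : seq stree) (t : stree) : stree :=
  let: Node s ts := t in
  let t' := Node s [seq subst sigma u t1 | t1 <- ts] in
  if s is Nt n then
    if n \in sigma then
      vsubst [seq subst sigma u t1 | t1 <- ts] (nth t' u (index n sigma))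
    else t'
  else t'.

End Patterns.

(* The finite set of big nonterminals is the set of members of [bignt].
   The finite set of rules is indexed by the finite type [rules]; [rules_inj]
   says that different indices are different triples A -> (u, L), where the
   links L form a set.  The sequence [links r] lists that set in the linear
   order that is fixed for the derivation trees. *)
Record mcftg (Sigma : ralph) := MCFTG {
  nt : ralph;
  bignt : seq (seq nt);
  start : nt;
  rules : finType;
  lhs : rules -> seq nt;
  rhs : rules -> seq (stree nt Sigma);
  links : rules -> seq (seq nt);
  mr_gt0 : 0 < mr Sigma;
  bignt_neq0 : forall A, A \in bignt -> A != [::];
  bignt_uniq : forall A, A \in bignt -> uniq A;
  bignt_occ : forall A A', A \in bignt -> A' \in bignt -> A =i A' -> A = A';
  start_bignt : [:: start] \in bignt;
  start_rk : rk start = 0;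
  rules_inj : forall r r',
    lhs r = lhs r' -> rhs r = rhs r' -> links r =i links r' -> r = r';
  lhs_bignt : forall r, lhs r \in bignt;
  rhs_pattern : forall r, all2 (fun A t => pattern (rk A) t) (lhs r) (rhs r);
  rhs_uniq : forall r, uniq (nts (rhs r));
  links_bignt : forall r, {subset links r <= bignt};
  (* as links are nonempty and repetition-free: no link is listed twice and
     their occurrence sets are pairwise disjoint *)
  links_disj : forall r, uniq (flatten (links r));
  links_cover : forall r, flatten (links r) =i nts (rhs r);
  start_separated : forall r, start \notin nts (rhs r)
}.

Section Grammar.
Variables (Sigma : ralph) (G : mcftg Sigma).

Definition multiplicity : nat := \max_(A <- bignt G) size A.

Definition width : nat := mr (nt G).

Definition monadic : Prop := width <= 1.

Definition rules_alph : ralph :=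
  @RAlph (rules G) (fun r => size (links r)).

(* d is in L(G_der, A); [all2] also requires as many subtrees as links. *)
Fixpoint der (d : tree rules_alph) (A : seq (nt G)) : bool :=
  let: Node r ds := d in
  (A == lhs r) && all2 (fun p B => p B) [seq der d' | d' <- ds] (links r).

Definition derivation (d : tree rules_alph) : bool := der d [:: start G].

Fixpoint dval (d : tree rules_alph) : seq (stree (nt G) Sigma) :=
  let: Node r ds := d in
  [seq subst (flatten (links (r : rules G))) (flatten [seq dval d' | d' <- ds]) t
     | t <- rhs (r : rules G)].

(* val(d) = t, with t a tree over the terminals only, so that the values of
   derivation trees of different grammars can be compared. *)
Definition yields (d : tree rules_alph) (t : tree Sigma) : Prop :=
  dval d = [:: tmap Tm t].

Definition initial (r : rules G) : bool := lhs r == [:: start G].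

Definition terminal (r : rules G) : bool := links r == [::].

Definition proper (r : rules G) : bool := ~~ (initial r && terminal r).

Definition lexicalized_rule (Delta : {set Sigma}) (r : rules G) : bool :=
  has (mem Delta) (tms (rhs r)).

Definition lexicalized (Delta : {set Sigma}) : Prop :=
  forall r : rules G, proper r -> lexicalized_rule Delta r.

End Grammar.

(* Regular tree languages, via total deterministic bottom-up tree automata. *)
Record bta (Omega : ralph) := BTA {
  bstate : finType;
  bstep : Omega -> seq bstate -> bstate;
  bfinal : {set bstate}
}.

Fixpoint brun (Omega : ralph) (A : bta Omega) (t : tree Omega) : bstate A :=
  let: Node a ts := t in bstep a [seq brun A s | s <- ts].

Definition regular (Omega : ralph) (L : tree Omega -> Prop) : Prop :=
  exists A : bta Omega,
    forall t, L t <-> ranked (@rk Omega) t /\ brun A t \in bfinal A.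

Definition disjoint_langs (Omega : ralph) (L L' : tree Omega -> Prop) : Prop :=
  forall t, ~ (L t /\ L' t).

(* Right-hand sides of transducer rules: [inl b] is an output symbol and
   [inr (q, i)] is <q, y_(i+1)> (input variables are numbered from 0). *)
Section OutTrees.
Variables (Q : finType) (Gamma : ralph).

Definition otree := tree (Gamma + Q * nat)%type.

Definition out_rk (s : Gamma + Q * nat) : nat := if s is inl b then rk b else 0.

Definition yvars (z : otree) : seq nat :=
  pmap (fun s => if s is inr p then Some p.2 else None) (labels z).

Fixpoint ysubst (f : Q -> nat -> tree Gamma) (z : otree) : tree Gamma :=
  let: Node s zs := z in
  match s with
  | inl b => Node b [seq ysubst f z' | z' <- zs]
  | inr p => f p.1 p.2
  end.

End OutTrees.

(* A rule r reads
   <tstate r, tsym r (y_1 : tla r 0, ..., y_k : tla r (k-1)) : tla0 r> -> tout r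
   with k the rank of [tsym r]; the value of [tla r] from k on is irrelevant. *)
Record ldtr (Omega Gamma : ralph) := LDTR {
  tstates : finType;
  tinit : tstates;
  trules : finType;
  tstate : trules -> tstates;
  tsym : trules -> Omega;
  tla0 : trules -> tree Omega -> Prop;
  tla : trules -> nat -> tree Omega -> Prop;
  tout : trules -> otree tstates Gamma;
  tla0_regular : forall r, regular (tla0 r);
  tla_regular : forall r i, i < rk (tsym r) -> regular (tla r i);
  tout_ranked : forall r, ranked (@out_rk tstates Gamma) (tout r);
  tout_yvars : forall r, all (fun i => i < rk (tsym r)) (yvars (tout r));
  tout_linear : forall r, uniq (yvars (tout r));
  tdeterministic : forall r r', r <> r' ->
    tstate r = tstate r' -> tsym r = tsym r' ->
    disjoint_langs (tla0 r) (tla0 r') \/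
    exists2 i, i < rk (tsym r) & disjoint_langs (tla r i) (tla r' i)
}.

(* [trun M q s t] is M_q(s) = t, as the graph of a partial function. *)
Inductive trun (Omega Gamma : ralph) (M : ldtr Omega Gamma) :
    tstates M -> tree Omega -> tree Gamma -> Prop :=
| Trun (r : trules M) (ss : seq (tree Omega))
       (f : tstates M -> nat -> tree Gamma) :
    let s := Node (tsym r) ss in
    size ss = rk (tsym r) ->
    tla0 r s ->
    (forall i, i < size ss -> tla r i (nth s ss i)) ->
    (forall q i, inr (q, i) \in labels (tout r) -> trun q (nth s ss i) (f q i)) ->
    trun (tstate r) s (ysubst f (tout r)).

Definition transduction (Omega Gamma : ralph) (M : ldtr Omega Gamma) :
    tree Omega -> tree Gamma -> Prop := trun (tinit M).

Section Equivalence.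
Variable Sigma : ralph.

Definition preserves_values (G G' : mcftg Sigma)
    (M : ldtr (rules_alph G) (rules_alph G')) : Prop :=
  forall d, derivation d ->
    exists d', [/\ transduction M d d', derivation d' &
                   exists t : tree Sigma, yields d t /\ yields d' t].

Definition ldtr_equivalent (G G' : mcftg Sigma) : Prop :=
  (exists M : ldtr (rules_alph G) (rules_alph G'), preserves_values M) /\
  (exists M' : ldtr (rules_alph G') (rules_alph G), preserves_values M').

End Equivalence.

(* Main.v *)
Require Import Defs.
From HB Require Import structures.
From mathcomp Require Import all_boot zify.

Set Implicit Arguments.
Unset Strict Implicit.
Unset Printing Implicit Defensive.

(** Cut the value [t] of a nonterminal of rank [k >= 2] at its branching nodes,
i.e. the nodes with at least two subtrees that contain variables.  There are at
most [k - 1] of them, and what remains are at most [(2k - 1) mr] pieces of rank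
at most 1.  The tree of branching nodes with its holes for the pieces is the
shape of [t]; for a fixed grammar there are finitely many shapes.  The new
grammar guesses for every nonterminal [C] the shape of its value and replaces [C]
by one nonterminal per hole.  A new rule is an old rule together with shapes for
the nonterminals of its right-hand side: these shapes are substituted into the
right-hand side, which is then cut into pieces in the same way, and the shape
that results is the one of the left-hand side.  As shapes are thus computed
bottom-up, regular look-ahead turns old derivations into new ones by relabelling;
the converse relabelling just forgets the shapes.  Branching nodes have positive
rank, so terminals of rank 0 remain in the pieces. *)

(** * Trees and symbols *)

Fixpoint gentree_of (A : Type) (t : tree A) : GenTree.tree A :=
  let: Node a ts := t in
  GenTree.Node 0 (GenTree.Leaf a :: [seq gentree_of s | s <- ts]).

Fixpoint of_gentree (A : Type) (g : GenTree.tree A) : option (tree A) :=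
  if g is GenTree.Node _ (GenTree.Leaf a :: gs) then
    Some (Node a (pmap id [seq of_gentree h | h <- gs]))
  else None.

Lemma gentree_ofK (A : Type) : pcancel (@gentree_of A) (@of_gentree A).
Proof.
rewrite /pcancel; fix IH 1; case=> a ts /=; congr (Some (Node a _)).
by elim: ts => //= t ts ->; rewrite IH.
Qed.

HB.instance Definition _ (A : eqType) :=
  Equality.copy (tree A) (pcan_type (@gentree_ofK A)).
HB.instance Definition _ (A : choiceType) :=
  Choice.copy (tree A) (pcan_type (@gentree_ofK A)).

Definition sum_of_sym (N S : Type) (s : sym N S) : N + S + nat :=
  match s with Nt n => inl (inl n) | Tm a => inl (inr a) | Var i => inr i end.

Definition sym_of_sum (N S : Type) (x : N + S + nat) : sym N S :=
  match x with inl (inl n) => Nt n | inl (inr a) => Tm a | inr i => Var i end.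

Lemma sum_of_symK (N S : Type) : cancel (@sum_of_sym N S) (@sym_of_sum N S).
Proof. by case. Qed.

HB.instance Definition _ (N S : eqType) :=
  Equality.copy (sym N S) (can_type (@sum_of_symK N S)).
HB.instance Definition _ (N S : choiceType) :=
  Choice.copy (sym N S) (can_type (@sum_of_symK N S)).

(** Replaces the generated induction principle, which gives no hypothesis on the subtrees nested in
    the list. *)
Lemma tree_indP (A : eqType) (Q : tree A -> Prop) :
  (forall a ts, {in ts, forall t, Q t} -> Q (Node a ts)) -> forall t, Q t.
Proof.
move=> H; fix IH 1; case=> a ts; apply: H.
(* [IH] is cleared before automation runs, since using it on anything but a subterm breaks the guard
   condition. *)
elim: ts => [|t ts IHts] s; first by clear IH; rewrite in_nil.
by have := IH t; clear IH => Qt; rewrite in_cons => /predU1P[->|/IHts].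
Qed.

(** * Substitution between alphabets *)

Definition smap (S P Q : Type) (f : P -> Q) (s : sym P S) : sym Q S :=
  match s with Nt p => Nt (f p) | Tm a => Tm a | Var i => Var i end.

Definition getNt (P S : Type) (s : sym P S) := if s is Nt p then Some p else None.
Definition getTm (P S : Type) (s : sym P S) := if s is Tm a then Some a else None.
Definition getVar (P S : Type) (s : sym P S) := if s is Var i then Some i else None.

Section Skeletons.
Variable Sigma : ralph.

(** The label type [P] is arbitrary because skeletons occur over nonterminals, over booleans (the
    ranks of holes), over numbered booleans and, for a cut pattern, over the pieces themselves. *)
Definition skel (P : Type) := tree (sym P Sigma).

Definition srk (P : Type) (r : P -> nat) (s : sym P Sigma) : nat :=
  match s with Nt p => r p | Tm a => rk a | Var _ => 0 end.

Definition gnts (P : Type) (t : skel P) : seq P := pmap (@getNt P Sigma) (labels t).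
Definition gtms (P : Type) (t : skel P) : seq Sigma := pmap (@getTm P Sigma) (labels t).
Definition gvars (P : Type) (t : skel P) : seq nat := pmap (@getVar P Sigma) (labels t).

(* Like [subst], but source and target nonterminals may differ. *)
Fixpoint hsub (P : Type) (N : ralph) (f : P -> stree N Sigma) (t : skel P) :
    stree N Sigma :=
  let: Node s ts := t in
  let us := [seq hsub f u | u <- ts] in
  match s with
  | Nt p => vsubst us (f p)
  | Tm a => Node (Tm a) us
  | Var i => Node (Var i) us
  end.

Lemma pmap_flatten (A B : Type) (g : A -> option B) (ss : seq (seq A)) :
  pmap g (flatten ss) = flatten [seq pmap g s | s <- ss].
Proof. by elim: ss => //= s ss <-; rewrite pmap_cat. Qed.

Lemma gnts_node (P : Type) (s : sym P Sigma) ts :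
  gnts (Node s ts) = oapp (fun p => [:: p]) [::] (getNt s) ++ flatten [seq gnts t | t <- ts].
Proof. by rewrite /gnts /= pmap_flatten -map_comp; case: s. Qed.

Lemma gtms_node (P : Type) (s : sym P Sigma) ts :
  gtms (Node s ts) = oapp (fun p => [:: p]) [::] (getTm s) ++ flatten [seq gtms t | t <- ts].
Proof. by rewrite /gtms /= pmap_flatten -map_comp; case: s. Qed.

Lemma gvars_node (P : Type) (s : sym P Sigma) ts :
  gvars (Node s ts) = oapp (fun p => [:: p]) [::] (getVar s) ++ flatten [seq gvars t | t <- ts].
Proof. by rewrite /gvars /= pmap_flatten -map_comp; case: s. Qed.

Lemma gnts_node1 (P : Type) (s : sym P Sigma) t :
  gnts (Node s [:: t]) = oapp (fun p => [:: p]) [::] (getNt s) ++ gnts t.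
Proof. by rewrite gnts_node /= cats0. Qed.

Lemma gtms_node1 (P : Type) (s : sym P Sigma) t :
  gtms (Node s [:: t]) = oapp (fun p => [:: p]) [::] (getTm s) ++ gtms t.
Proof. by rewrite gtms_node /= cats0. Qed.

Lemma ntsE (N : ralph) (u : seq (stree N Sigma)) : nts u = flatten [seq gnts t | t <- u].
Proof. by rewrite /nts pmap_flatten -map_comp. Qed.

Lemma tmsE (N : ralph) (u : seq (stree N Sigma)) : tms u = flatten [seq gtms t | t <- u].
Proof. by rewrite /tms pmap_flatten -map_comp. Qed.

Lemma patternE (N : ralph) k (t : stree N Sigma) :
  pattern k t = ranked (srk (@rk N)) t && perm_eq (gvars t) (iota 0 k).
Proof. by []. Qed.

Lemma labels_tmap (A B : Type) (f : A -> B) (t : tree A) :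
  labels (tmap f t) = map f (labels t).
Proof.
move: t; fix IH 1; case=> a ts /=; congr (_ :: _).
by elim: ts => //= t ts ->; rewrite IH map_cat.
Qed.

Lemma tmap_comp (A B C : Type) (f : B -> C) (g : A -> B) (t : tree A) :
  tmap f (tmap g t) = tmap (f \o g) t.
Proof.
move: t; fix IH 1; case=> a ts /=; congr Node.
by elim: ts => //= t ts ->; rewrite IH.
Qed.

Lemma eq_tmap (A B : Type) (f g : A -> B) : f =1 g -> tmap f =1 tmap g.
Proof.
move=> e; rewrite /eqfun; fix IH 1; case=> a ts /=; rewrite e; congr Node.
by elim: ts => //= t ts ->; rewrite IH.
Qed.

Lemma gnts_smap (P Q : Type) (f : P -> Q) (t : skel P) :
  gnts (tmap (smap f) t) = map f (gnts t).
Proof. by rewrite /gnts labels_tmap; elim: (labels t) => //= -[p|a|i] ls /= ->. Qed.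

Lemma gvars_smap (P Q : Type) (f : P -> Q) (t : skel P) :
  gvars (tmap (smap f) t) = gvars t.
Proof. by rewrite /gvars labels_tmap; elim: (labels t) => //= -[p|a|i] ls /= ->. Qed.

Lemma ranked_smap (P Q : Type) (f : P -> Q) (r : Q -> nat) (t : skel P) :
  ranked (srk r) (tmap (smap f) t) = ranked (srk (r \o f)) t.
Proof.
move: t; fix IH 1; case=> a ts /=; rewrite size_map; congr (_ && _); first by case: a.
by elim: ts => //= t ts ->; rewrite IH.
Qed.

Lemma hsub_smap (P Q : Type) (N : ralph) (h : P -> Q) (f : Q -> stree N Sigma) (t : skel P) :
  hsub f (tmap (smap h) t) = hsub (f \o h) t.
Proof.
move: t; fix IH 1; case=> a ts /=.
rewrite -map_comp (_ : map _ ts = [seq hsub (f \o h) u | u <- ts]); first by case: a.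
by elim: ts => //= t ts ->; rewrite IH.
Qed.

Lemma eq_in_hsub (P : eqType) (N : ralph) (f g : P -> stree N Sigma) (t : skel P) :
  {in gnts t, f =1 g} -> hsub f t = hsub g t.
Proof.
elim/tree_indP: t => s ts IH; rewrite gnts_node => e /=.
rewrite (_ : [seq hsub f u | u <- ts] = [seq hsub g u | u <- ts]); last first.
  apply/eq_in_map => u u_ts; apply: IH => // p p_u; apply: e; rewrite mem_cat.
  by apply/orP; right; apply/flatten_mapP; exists u.
by case: s e => // p e; rewrite e // mem_cat mem_head.
Qed.

(** A variable beyond [us] would survive the inner substitution and then be hit by [ss] on the left
    only; hence the bound on the variables. *)
Lemma vsubst_comp (N : ralph) (ss us : seq (stree N Sigma)) (t : stree N Sigma) :
  all (fun i => i < size us) (gvars t) ->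
  vsubst ss (vsubst us t) = vsubst [seq vsubst ss u | u <- us] t.
Proof.
elim/tree_indP: t => s ts IH; rewrite gvars_node all_cat => /andP[e ets].
have IHts : [seq vsubst ss (vsubst us u) | u <- ts] =
            [seq vsubst [seq vsubst ss u | u <- us] u | u <- ts].
  apply/eq_in_map => u u_ts; apply: IH => //; apply/allP=> i i_u; apply: (allP ets).
  by apply/flatten_mapP; exists u.
case: s e => [p|a|i] /= e; rewrite -?map_comp -?IHts //.
by rewrite andbT in e; rewrite (nth_map (Node (Var i) ts)).
Qed.

Lemma hsub_vsubst (N1 N2 : ralph) (f : N1 -> stree N2 Sigma) us (t : stree N1 Sigma) :
  ranked (srk (@rk N1)) t ->
  {in gnts t, forall n, all (fun i => i < rk n) (gvars (f n))} ->
  hsub f (vsubst us t) = vsubst [seq hsub f u | u <- us] (hsub f t).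
Proof.
elim/tree_indP: t => s ts IH /= /andP[sz rts]; rewrite gnts_node => fP.
have IHts : [seq hsub f (vsubst us u) | u <- ts] =
            [seq vsubst [seq hsub f u | u <- us] (hsub f u) | u <- ts].
  apply/eq_in_map => u u_ts; apply: IH => //; first exact: (allP rts).
  move=> p p_u; apply: fP; rewrite mem_cat; apply/orP; right.
  by apply/flatten_mapP; exists u.
case: s sz fP => [p|a|i] /= sz fP; rewrite -?map_comp.
- rewrite vsubst_comp -?map_comp; first by rewrite -[in RHS]IHts.
  by rewrite size_map (eqP sz); apply: fP; rewrite mem_head.
- by rewrite -[in RHS]IHts.
- have [lt|ge] := ltnP i (size us); first by rewrite !(nth_map (Node (Var i) ts)).
  by rewrite !nth_default ?size_map.
Qed.

(** Unfolding shapes and gluing pieces are both instances of [hsub]; the comparison of values pushes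
    an interpretation through each of them. *)
Lemma hsub_comp (P : eqType) (N1 N2 : ralph) (g : P -> stree N1 Sigma)
    (f : N1 -> stree N2 Sigma) (t : skel P) :
  {in gnts t, forall p, ranked (srk (@rk N1)) (g p)} ->
  {in gnts t, forall p, {in gnts (g p), forall n, all (fun i => i < rk n) (gvars (f n))}} ->
  hsub f (hsub g t) = hsub (fun p => hsub f (g p)) t.
Proof.
elim/tree_indP: t => s ts IH; rewrite gnts_node => gP fP.
have IHts : [seq hsub f (hsub g u) | u <- ts] = [seq hsub (fun p => hsub f (g p)) u | u <- ts].
  apply/eq_in_map => u u_ts; apply: IH => // p p_u;
    [apply: gP | apply: fP]; rewrite mem_cat; apply/orP; right;
    by apply/flatten_mapP; exists u.
case: s gP fP => [p|a|i] /= gP fP; rewrite -?IHts -?map_comp //.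
by rewrite hsub_vsubst -?map_comp //; [apply: gP | apply: fP]; rewrite mem_head.
Qed.

End Skeletons.

Arguments gnts {Sigma P} t : simpl never.
Arguments gtms {Sigma P} t : simpl never.
Arguments gvars {Sigma P} t : simpl never.

(** * Symbol counts under substitution of patterns *)

Section Counting.
Variable Sigma : ralph.

Definition nonvar (P : Type) (s : sym P Sigma) : bool := if s is Var _ then false else true.

Lemma count_vsubst (N : ralph) (d : stree N Sigma) a us (t : stree N Sigma) :
  ranked (srk (@rk N)) t -> all (fun i => i < size us) (gvars t) ->
  count a (labels (vsubst us t)) =
  \sum_(s <- labels t) if s is Var i then count a (labels (nth d us i)) else (a s : nat).
Proof.
elim/tree_indP: t => s ts IH /= /andP[sz rts]; rewrite gvars_node all_cat => /andP[es ets].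
have IHts : \sum_(u <- ts) count a (labels (vsubst us u)) = \sum_(u <- ts) \sum_(s <- labels u)
    if s is Var i then count a (labels (nth d us i)) else (a s : nat).
  apply: eq_big_seq => u u_ts; apply: IH => //; first exact: (allP rts).
  by apply/allP=> i i_u; apply: (allP ets); apply/flatten_mapP; exists u.
rewrite big_cons big_flatten big_map -IHts.
case: s sz es => [p|b|i] /= sz es.
- by rewrite count_flatten sumnE !big_map.
- by rewrite count_flatten sumnE !big_map.
- move/nilP: sz => ->; rewrite big_nil addn0 (set_nth_default d) //.
  by rewrite andbT in es.
Qed.

(** Share of a single label of the skeleton in the labels of the result; the variables of [f p]
    vanish, since the arguments take their places. *)
Definition expand (P : Type) (N : ralph) (f : P -> stree N Sigma) (s : sym P Sigma) :
    seq (sym N Sigma) :=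
  match s with
  | Nt p => filter (@nonvar N) (labels (f p)) | Tm a => [:: Tm a] | Var i => [:: Var i]
  end.

Definition wf_env (P : eqType) (N : ralph) (r : P -> nat) (f : P -> stree N Sigma)
    (t : skel Sigma P) := {in gnts t, forall p, pattern (r p) (f p)}.

Lemma wf_env_sub (P : eqType) (N : ralph) r (f : P -> stree N Sigma) s ts :
  wf_env r f (Node s ts) -> {in ts, forall t, wf_env r f t}.
Proof.
move=> fP t t_ts p p_t; apply: fP; rewrite gnts_node mem_cat; apply/orP; right.
by apply/flatten_mapP; exists t.
Qed.

Lemma pattern_vars (N : ralph) k (t : stree N Sigma) :
  pattern k t -> all (fun i => i < k) (gvars t).
Proof.
by rewrite patternE => /andP[_ /perm_mem e]; apply/allP=> i; rewrite e mem_iota add0n.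
Qed.

(** A pattern uses each argument exactly once, so nothing is copied or lost and the multiset of
    labels is determined symbol by symbol. The counts of nonterminals, terminals and variables
    follow by filtering. *)
Lemma labels_hsub (P : eqType) (N : ralph) (r : P -> nat) (f : P -> stree N Sigma) t :
  ranked (srk r) t -> wf_env r f t ->
  perm_eq (labels (hsub f t)) (flatten [seq expand f s | s <- labels t]).
Proof.
move=> rt fP; apply/permP=> a; rewrite count_flatten sumnE !big_map.
elim/tree_indP: t rt fP => s ts IH /= /andP[sz rts] fP.
have IHts : \sum_(u <- ts) count a (labels (hsub f u)) =
    \sum_(u <- ts) \sum_(s <- labels u) count a (expand f s).
  apply: eq_big_seq => u u_ts; apply: IH => //; first exact: (allP rts).
  exact: (wf_env_sub fP).
rewrite big_cons big_flatten big_map -IHts.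
case: s sz fP => [p|b|i] /= sz fP.
- have fp : pattern (r p) (f p) by apply: fP; rewrite gnts_node mem_head.
  have d : stree N Sigma := f p.
  have /andP[rfp vfp] := fp.
  rewrite (count_vsubst d) //; last by rewrite size_map (eqP sz); exact: pattern_vars fp.
  (* Nonvariable labels of [f p] count for themselves, each variable for the argument put in its
     place. *)
  transitivity (\sum_(s <- labels (f p) | nonvar s) (a s : nat) +
     \sum_(i <- gvars (f p)) count a (labels (nth d [seq hsub f u | u <- ts] i))).
    rewrite /gvars; elim: (labels (f p)) => [|s l IHl]; first by rewrite !big_nil.
    rewrite !big_cons IHl; case: s => [q|b|i] //=; rewrite ?addnA //.
    by rewrite big_cons; lia.
  congr (_ + _); first by rewrite -sumn_count sumnE big_map big_filter.
  rewrite -(big_map (hsub f) xpredT (fun u => count a (labels u))).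
  (* The arguments are listed by position, and [gvars (f p)] is a permutation of the positions. *)
  rewrite -[in RHS](mkseq_nth d [seq hsub f u | u <- ts]) big_map size_map (eqP sz).
  exact: perm_big vfp.
- by rewrite count_flatten sumnE !big_map addn0.
- by rewrite count_flatten sumnE !big_map addn0.
Qed.

Lemma gnts_hsub (P : eqType) (N : ralph) (r : P -> nat) (f : P -> stree N Sigma) t :
  ranked (srk r) t -> wf_env r f t ->
  perm_eq (gnts (hsub f t)) (flatten [seq gnts (f p) | p <- gnts t]).
Proof.
move=> rt fP; apply: perm_trans (perm_pmap _ (labels_hsub rt fP)) _.
rewrite pmap_flatten -map_comp; apply/permP => a; congr count.
rewrite /gnts; elim: (labels t) => //= -[p|b|i] l /= -> //; congr (_ ++ _).
by elim: (labels (f p)) => //= -[q|b|i] l' //= ->.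
Qed.

Lemma gtms_hsub (P : eqType) (N : ralph) (r : P -> nat) (f : P -> stree N Sigma) t :
  ranked (srk r) t -> wf_env r f t ->
  perm_eq (gtms (hsub f t)) (gtms t ++ flatten [seq gtms (f p) | p <- gnts t]).
Proof.
move=> rt fP; apply: perm_trans (perm_pmap _ (labels_hsub rt fP)) _.
rewrite pmap_flatten -map_comp; apply/permP => a; rewrite count_cat.
rewrite /gtms /gnts; elim: (labels t) => //= -[p|b|i] l /= IH; rewrite ?count_cat IH //.
- rewrite addnCA; congr (_ + (_ + _)).
  by elim: (labels (f p)) => //= -[q|b|i] l' //= ->.
- by rewrite /= addnA.
Qed.

Lemma gvars_hsub (P : eqType) (N : ralph) (r : P -> nat) (f : P -> stree N Sigma) t :
  ranked (srk r) t -> wf_env r f t -> perm_eq (gvars (hsub f t)) (gvars t).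
Proof.
move=> rt fP; apply: perm_trans (perm_pmap _ (labels_hsub rt fP)) _.
rewrite pmap_flatten -map_comp; apply/permP => a; congr count.
rewrite /gvars; elim: (labels t) => //= -[p|b|i] l /= -> //.
by elim: (labels (f p)) => //= -[q|b|i] l' //= ->.
Qed.

Lemma ranked_vsubst (N : ralph) us (t : stree N Sigma) :
  all (ranked (srk (@rk N))) us -> ranked (srk (@rk N)) t ->
  ranked (srk (@rk N)) (vsubst us t).
Proof.
move=> rus; elim/tree_indP: t => s ts IH rt; case: s rt => [p|a|i] rt /=; last first.
  have [lt|ge] := ltnP i (size us); last by rewrite nth_default.
  by apply: (allP rus); apply: mem_nth.
all: move: rt => /= /andP[sz rts]; rewrite size_map sz /= all_map.
all: by apply/allP=> u u_ts /=; apply: IH => //; exact: (allP rts).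
Qed.

Lemma ranked_hsub (P : eqType) (N : ralph) (r : P -> nat) (f : P -> stree N Sigma) t :
  ranked (srk r) t -> wf_env r f t -> ranked (srk (@rk N)) (hsub f t).
Proof.
elim/tree_indP: t => s ts IH /= /andP[sz rts] fP.
have IHts : all (ranked (srk (@rk N))) [seq hsub f u | u <- ts].
  rewrite all_map; apply/allP=> u u_ts; apply: IH => //; first exact: (allP rts).
  exact: (wf_env_sub fP).
case: s sz fP => [p|b|i] /= sz fP; rewrite ?size_map ?sz //.
apply: ranked_vsubst => //.
by have /andP[] : pattern (r p) (f p) by apply: fP; rewrite gnts_node mem_head.
Qed.

Lemma pattern_hsub (P : eqType) (N : ralph) (r : P -> nat) (f : P -> stree N Sigma) t k :
  ranked (srk r) t -> wf_env r f t -> perm_eq (gvars t) (iota 0 k) ->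
  pattern k (hsub f t).
Proof.
move=> rt fP vt; rewrite patternE (ranked_hsub rt fP) /=.
exact: perm_trans (gvars_hsub rt fP) vt.
Qed.

End Counting.

(** * Cutting a pattern at its branching nodes *)

Fixpoint height (A : Type) (t : tree A) : nat :=
  let: Node _ ts := t in (\max_(h <- [seq height u | u <- ts]) h).+1.

Section Decomposition.
Variables N Sigma : ralph.
Hypothesis N_monadic : forall n : N, rk n <= 1.

Local Notation pat := (stree N Sigma).

Definition hasvar (t : pat) : bool := gvars t != [::].

Definition x0 : pat := Node (Var 0) [::].

Definition top_piece (d : skel Sigma pat) : pat := if d is Node (Nt p) _ then p else x0.

Definition below (d : skel Sigma pat) : seq (skel Sigma pat) := let: Node _ us := d in us.

(** Built for exactly one child with variables: [s] is put on top of that child's top piece, closed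
    siblings stay whole inside the piece, and the rest of that child's skeleton hangs below. *)
Definition chain (s : sym N Sigma) (ts : seq (pat * skel Sigma pat)) : skel Sigma pat :=
  Node (Nt (Node s [seq if hasvar x.1 then top_piece x.2 else x.1 | x <- ts]))
    (flatten [seq if hasvar x.1 then below x.2 else [::] | x <- ts]).

(* The spine of [t] that leads to its variables is cut at the nodes with at
   least two subtrees containing variables; only these nodes remain as
   terminals, and every maximal rest becomes a piece of rank at most 1.
   Pieces and remaining nodes alternate, so some pieces are just [x0]. *)
Fixpoint dec (t : pat) : skel Sigma pat :=
  let: Node s ts := t in
  if ~~ hasvar t then Node (Nt t) [::] else
  match s with
  | Var i => Node (Nt x0) [:: Node (Var i) [::]]
  | Nt n => chain (Nt n) [seq (u, dec u) | u <- ts]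
  | Tm a =>
    if count hasvar ts <= 1 then chain (Tm a) [seq (u, dec u) | u <- ts]
    else Node (Nt x0) [:: Node (Tm a) [seq dec u | u <- ts]]
  end.

Lemma dec_root t : exists p us, dec t = Node (Nt p) us.
Proof.
case: t => s ts /=; case: ifP => _; first by eexists; eexists.
case: s => [n|a|i]; rewrite /chain; try by eexists; eexists.
by case: ifP => _; eexists; eexists.
Qed.

Lemma novar_split (ts : seq pat) : 0 < count hasvar ts <= 1 ->
  exists l c r, [/\ ts = l ++ c :: r, hasvar c, all (predC hasvar) l & all (predC hasvar) r].
Proof.
case/andP; rewrite -has_count => /split_find [c l r hc hl].
rewrite -cats1 count_cat count_cat /= hc addn0 => le1.
exists l, c, r; split => //; first by rewrite -catA.
- by rewrite all_predC.
- by rewrite all_predC has_count -leqNgt; lia.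
Qed.

Lemma hasvar_node s ts : hasvar (Node s ts) =
  (if s is Var _ then true else false) || has hasvar ts.
Proof.
rewrite /hasvar gvars_node; case: s => [p|a|i] //=; elim: ts => //= t ts <-.
all: by rewrite -!size_eq0 size_cat addn_eq0 negb_and.
Qed.

Lemma chain_split s l c r p us : hasvar c -> all (predC hasvar) l -> all (predC hasvar) r ->
  dec c = Node (Nt p) us ->
  chain s [seq (u, dec u) | u <- l ++ c :: r] = Node (Nt (Node s (l ++ p :: r))) us.
Proof.
move=> hc hl hr ec.
have novar (ts : seq pat) : all (predC hasvar) ts ->
    ([seq if hasvar x.1 then top_piece x.2 else x.1 | x <- [seq (u, dec u) | u <- ts]] = ts) *
    (flatten [seq if hasvar x.1 then below x.2 else [::] | x <- [seq (u, dec u) | u <- ts]] = [::]).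
  by elim: ts => //= t ts IH /andP[/negPf-> /IH[-> ->]].
by rewrite /chain !map_cat /= hc ec flatten_cat /= !novar //= cats0.
Qed.

(** Induction along [dec], one case for each way of cutting: closed tree, variable, a single child
    with variables, branching terminal. Nonterminals have rank at most 1, so their nodes never
    branch and fall under the first or the third case. *)
Lemma dec_ind (Q : pat -> skel Sigma pat -> Prop) :
  (forall t, ranked (srk (@rk N)) t -> gvars t = [::] -> Q t (Node (Nt t) [::])) ->
  (forall i, Q (Node (Var i) [::]) (Node (Nt x0) [:: Node (Var i) [::]])) ->
  (forall s l c r p us, nonvar s -> ranked (srk (@rk N)) (Node s (l ++ c :: r)) ->
     all (predC hasvar) l -> all (predC hasvar) r -> hasvar c ->
     Q c (Node (Nt p) us) -> Q (Node s (l ++ c :: r)) (Node (Nt (Node s (l ++ p :: r))) us)) ->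
  (forall a ts, ranked (srk (@rk N)) (Node (Tm a) ts) -> 1 < count hasvar ts ->
     {in ts, forall u, Q u (dec u)} ->
     Q (Node (Tm a) ts) (Node (Nt x0) [:: Node (Tm a) [seq dec u | u <- ts]])) ->
  forall t, ranked (srk (@rk N)) t -> Q t (dec t).
Proof.
move=> Qclosed Qvar Qchain Qbranch; elim/tree_indP => s ts IH rt.
have QIH : {in ts, forall u, Q u (dec u)}.
  by move=> u u_ts; apply: IH => //; move/andP: rt => [_ /allP]; apply.
have Qch : nonvar s -> 0 < count hasvar ts <= 1 ->
    Q (Node s ts) (chain s [seq (u, dec u) | u <- ts]).
  move=> ns /novar_split [l [c [r [ets hc hl hr]]]]; have [p [us ec]] := dec_root c.
  rewrite ets (chain_split s hc hl hr ec); rewrite ets in rt; apply: Qchain => //.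
  by rewrite -ec; apply: QIH; rewrite ets mem_cat mem_head orbT.
rewrite /=; case: ifPn => [/negPn/eqP|]; first exact: Qclosed.
rewrite negbK hasvar_node.
case: s rt Qch => [n|a|i] rt Qch /= hts.
- apply: Qch => //; rewrite -has_count hts; apply: leq_trans (count_size _ _) _.
  by move/andP: rt => [/eqP-> _]; apply: N_monadic.
- have := Qch isT; rewrite -has_count hts /=; case: ifP => [_|/negbT]; first exact.
  by rewrite -ltnNge => ? _; apply: Qbranch.
- by move: rt => /= /andP[/nilP-> _].
Qed.

Lemma vsubst_closed (us : seq pat) (t : pat) : gvars t = [::] -> vsubst us t = t.
Proof.
elim/tree_indP: t => s ts IH; rewrite gvars_node => e.
have IHts : [seq vsubst us u | u <- ts] = ts.
  rewrite -[RHS]map_id; apply/eq_in_map => u u_ts; apply: IH => //.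
  move: e; case: (oapp _ _ _) => //=; elim: ts u_ts => //= t ts IHs.
  by rewrite in_cons => /predU1P[->|/IHs{}IHs]; case: (gvars _) => // /IHs.
by case: s e => [n|a|i] //= e; rewrite IHts.
Qed.

Lemma vsubst_nil (t : pat) : vsubst [::] t = t.
Proof.
elim/tree_indP: t => s ts IH /=.
have -> : [seq vsubst [::] u | u <- ts] = ts by rewrite -[RHS]map_id; apply/eq_in_map.
by case: s => //= i; rewrite nth_nil.
Qed.

Definition prk (p : pat) : nat := hasvar p.

Lemma gvars_chain s l c r : nonvar s -> all (predC hasvar) l -> all (predC hasvar) r ->
  gvars (Node s (l ++ c :: r)) = gvars c.
Proof.
move=> ns hl hr; rewrite gvars_node map_cat flatten_cat /=.
have novar (ts : seq pat) : all (predC hasvar) ts -> flatten [seq gvars t | t <- ts] = [::].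
  by elim: ts => //= u ts IH /andP[/negPn/eqP-> /IH].
by rewrite !novar // cats0; case: (s) ns.
Qed.

(** The environment is [id] because the nonterminals of [dec t] are the pieces themselves. *)
Lemma dec_correct t : ranked (srk (@rk N)) t ->
  [/\ ranked (srk prk) (dec t), wf_env prk id (dec t) & hsub id (dec t) = t].
Proof.
move: t; apply: (dec_ind (Q := fun t d =>
  [/\ ranked (srk prk) d, wf_env prk id d & hsub id d = t]))
  => [t rt vt|i|s l c r p us ns rt hl hr hc [rd wd ed]|a ts rt cnt IH].
- rewrite /prk /hasvar /= vt vsubst_nil; split => // p; rewrite gnts_node inE => /eqP->.
  by rewrite patternE /hasvar /prk rt vt.
- by split => // p; rewrite inE => /eqP->.
- have vc := gvars_hsub rd wd; rewrite ed in vc.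
  have := wd p (mem_head _ _); rewrite /prk => pp.
  (* A top piece without variables would have no skeleton below it, and then [c] would contain no
     variable. *)
  case hp : (hasvar p) in pp; last first.
    move: rd => /=; rewrite /prk hp /= => /andP[/nilP e0 _].
    by move: hc; rewrite /hasvar -size_eq0 (perm_size vc) e0.
  have ev := gvars_chain p ns hl hr.
  have hp' : hasvar (Node s (l ++ p :: r)) by rewrite /hasvar ev.
  have pp' : pattern true (Node s (l ++ p :: r)).
    move: pp; rewrite !patternE ev => /andP[rp ->]; rewrite andbT.
    move: rt; rewrite /= !size_cat /= !all_cat /= => /andP[-> /and3P[-> _ ->]].
    by rewrite rp.
  split.
  + by move: rd; rewrite /= /prk hp' hp.
  + move=> q; rewrite gnts_node /= in_cons => /predU1P[->|q_us]; first by rewrite /prk hp'.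
    by apply: wd; rewrite gnts_node /= in_cons q_us orbT.
  + have novar (ts : seq pat) ss : all (predC hasvar) ts -> [seq vsubst ss t | t <- ts] = ts.
      by elim: ts => //= u ts IH /andP[/negPn/eqP /vsubst_closed-> /IH->].
    have es : [seq vsubst [seq hsub id u | u <- us] t' | t' <- l ++ p :: r] = l ++ c :: r.
      by rewrite map_cat /= !novar // -[in RHS]ed.
    by case: (s) ns => // x _ /=; rewrite es.
- have IHr u : u \in ts -> ranked (srk prk) (dec u) by case/IH.
  have IHw u : u \in ts -> wf_env prk id (dec u) by case/IH.
  have IHe u : u \in ts -> hsub id (dec u) = u by case/IH.
  split.
  + rewrite /= /prk /= size_map; move/andP: rt => [-> _] /=; rewrite andbT all_map.
    exact/allP.
  + move=> q; rewrite gnts_node1 gnts_node /= in_cons => /predU1P[->//|].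
    rewrite -map_comp => /flatten_mapP[u u_ts /=]; exact: IHw.
  + rewrite /= -map_comp; congr Node; rewrite -[RHS]map_id; exact/eq_in_map.
Qed.

(** Only branching nodes stay outside the pieces, and these have at least two children. *)
Lemma dec_tms t : ranked (srk (@rk N)) t -> {in gtms (dec t), forall a, rk a != 0}.
Proof.
move: t; apply: (dec_ind (Q := fun _ d => {in gtms d, forall a, rk a != 0}))
  => // a ts /andP[sz _] cnt IH.
move=> b; rewrite gtms_node1 gtms_node /= in_cons => /predU1P[->|].
  rewrite -lt0n; move: sz => /= /eqP <-.
  exact: leq_trans (ltnW cnt) (count_size _ _).
by rewrite -map_comp => /flatten_mapP[u u_ts /=]; exact: IH.
Qed.

(** Every child of a branching node has fewer variables than the node, which pays for the two levels
    added by the node and the piece [x0] above it. *)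
Lemma dec_height t : ranked (srk (@rk N)) t -> height (dec t) <= (size (gvars t)).*2.+1.
Proof.
move: t.
apply: (dec_ind (Q := fun t d => height d <= (size (gvars t)).*2.+1))
  => [t _ _|i|s l c r p us ns _ hl hr _|a ts rt cnt IH] //=.
- by rewrite big_nil.
- by rewrite !big_cons !big_nil.
- by rewrite gvars_chain.
- rewrite big_cons big_nil maxn0 !ltnS gvars_node /= -map_comp big_map.
  have count_vars (us : seq pat) : count hasvar us <= size (flatten [seq gvars v | v <- us]).
    elim: us => //= v us IHs; rewrite size_cat leq_add // /hasvar.
    by case: (gvars v).
  have -> m k : 0 < k -> (m < k) = (m <= k.-1) by case: k.
    apply/bigmax_leqP_seq => u u_ts _; apply: leq_trans (IH _ u_ts) _.
    move: cnt; case/splitPr: u_ts => l r; rewrite count_cat /=.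
    have := count_vars l; have := count_vars r.
    by rewrite map_cat flatten_cat /= !size_cat; case: (hasvar u); lia.
  by rewrite double_gt0; apply: leq_trans (count_vars ts); apply: ltnW.
Qed.

(** With [k > 0] variables and maximal rank [m] the bound is [(2k-1)m]; the [maxn 1] serves closed
    trees, which are one piece. *)
Lemma dec_size t : 0 < mr Sigma -> ranked (srk (@rk N)) t ->
  size (gnts (dec t)) <= maxn 1 ((size (gvars t)).*2.-1 * mr Sigma).
Proof.
move=> m_gt0; move: t.
apply: (dec_ind (Q := fun t d =>
  size (gnts d) <= maxn 1 ((size (gvars t)).*2.-1 * mr Sigma)))
  => [t _ _|i|s l c r p us ns _ hl hr _|a ts /andP[/eqP sz _] cnt IH].
- by rewrite gnts_node leq_maxl.
- by rewrite gnts_node1 leq_maxl.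
- by rewrite gvars_chain // !gnts_node /=.
- have szm : size ts <= mr Sigma by rewrite sz /= leq_bigmax.
  move: (mr Sigma) m_gt0 szm IH => m m_gt0 szm IH.
  rewrite gnts_node1 gnts_node gvars_node /= -map_comp.
  (* A child with [k > 0] variables has at most [(2k-1)m] pieces and a closed child has one; this
     inequality is the sum. As at least two children have variables and there are at most [m]
     children, it leaves room for the piece [x0] of the node. *)
  suff : size (flatten [seq (@gnts Sigma _ \o dec) u | u <- ts]) + count hasvar ts * m.+1 <=
      2 * m * size (flatten [seq gvars u | u <- ts]) + size ts.
    move: (size (flatten _)) (size (flatten _)) (count _ _) cnt => x k b.
    have : 0 < k \/ k = 0 by lia.
    by nia.
  elim: ts {sz cnt szm} IH => //= u ts IHs IH.
  have {}IHs := IHs (fun v v_ts => IH v (mem_behead (s := u :: ts) v_ts)).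
  have := IH u (mem_head _ _); rewrite !size_cat.
  rewrite /hasvar -size_eq0; move: IHs.
  move: (size (gnts _)) (size (flatten _)) (size (flatten _)) (count _ _) => x y z c.
  case: (size (gvars u)) => [|k] /= IHs; rewrite leq_max => le_x; first by lia.
  have {}le_x : x <= k.*2.+1 * m by nia.
  by rewrite -mul2n in le_x; nia.
Qed.

End Decomposition.

(** * Finitely many shapes, numbered holes *)

Fixpoint seqs_upto (A : Type) (m : nat) (s : seq A) : seq (seq A) :=
  if m is m'.+1 then [::] :: [seq x :: l | x <- s, l <- seqs_upto m' s] else [:: [::]].

Lemma mem_seqs_upto (A : eqType) m (s l : seq A) :
  size l <= m -> {subset l <= s} -> l \in seqs_upto m s.
Proof.
elim: m l => [|m IH] [|x l] //= lt_m sub; rewrite in_cons; apply/orP; right.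
by apply/allpairsP; exists (x, l); split; rewrite ?sub ?mem_head ?IH // => y yl;
  apply: sub; rewrite in_cons yl orbT.
Qed.

Fixpoint trees_upto (A : Type) (L : seq A) (m h : nat) : seq (tree A) :=
  if h is h'.+1 then [seq Node a ts | a <- L, ts <- seqs_upto m (trees_upto L m h')]
  else [::].

Lemma mem_trees_upto (A : eqType) (L : seq A) (r : A -> nat) m h (t : tree A) :
  (forall a, r a <= m) -> ranked r t -> {subset labels t <= L} -> height t <= h ->
  t \in trees_upto L m h.
Proof.
move=> r_m; elim/tree_indP: t h => a ts IH [//|h] /= /andP[/eqP sz rts] sub hts.
apply/allpairsP; exists (a, ts); split=> //=; first exact/sub/mem_head.
apply: mem_seqs_upto => [|u u_ts]; first by rewrite sz.
apply: IH => //; first exact: (allP rts).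
- by move=> b b_u; apply: sub; rewrite in_cons; apply/orP; right; apply/flatten_mapP; exists u.
- move: hts; rewrite ltnS big_map; apply: leq_trans.
  exact: (@leq_bigmax_seq _ ts xpredT (@height A)).
Qed.

(** Preorder numbering from [n]; the inner fixpoint moves the counter past the labels of each
    subtree. *)
Fixpoint number (A : Type) (n : nat) (t : tree A) : tree (nat * A) :=
  let: Node a ts := t in
  Node (n, a) ((fix go n ts := if ts is u :: us then number n u :: go (n + size (labels u)) us
                               else [::]) n.+1 ts).

Lemma number_tmap (A B : Type) (f : A -> B) n (t : tree A) :
  number n (tmap f t) = tmap (fun x => (x.1, f x.2)) (number n t).
Proof.
move: t n; fix IH 1; case=> a ts n /=; congr Node.
elim: ts n.+1 => {n} //= t ts IHts n; rewrite IH IHts labels_tmap size_map; by [].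
Qed.

Lemma tmap_snd_number (A : Type) n (t : tree A) : tmap snd (number n t) = t.
Proof.
move: t n; fix IH 1; case=> a ts n /=; congr Node.
by elim: ts n.+1 => {n} //= t ts IHts n; rewrite IH IHts.
Qed.

Lemma labels_number (A : Type) n (t : tree A) :
  labels (number n t) = zip (iota n (size (labels t))) (labels t).
Proof.
move: t n; fix IH 1; case=> a ts n /=; congr (_ :: _).
elim: ts n.+1 => {n} //= t ts IHts n.
by rewrite IH IHts size_cat iotaD zip_cat ?size_iota.
Qed.

Section Numbering.
Variable Sigma : ralph.

Definition num (P : Type) (t : skel Sigma P) : skel Sigma (nat * P) :=
  tmap (fun x => smap (pair x.1) x.2) (number 0 t).

(** Numbers depend on positions only. Hence the holes of a shape and the pieces of a tree of that
    shape carry the same numbers. *)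
Lemma num_smap (P Q : Type) (f : P -> Q) (t : skel Sigma P) :
  num (tmap (smap f) t) = tmap (smap (fun x => (x.1, f x.2))) (num t).
Proof.
by rewrite /num number_tmap !tmap_comp; apply: eq_tmap => -[i [p|a|j]].
Qed.

Lemma tmap_snd_num (P : Type) (t : skel Sigma P) : tmap (smap snd) (num t) = t.
Proof.
rewrite /num tmap_comp -[RHS](tmap_snd_number 0).
by apply: eq_tmap => -[i [p|a|j]].
Qed.

Lemma num_fst (P : Type) (t : skel Sigma P) :
  subseq (map fst (gnts (num t))) (iota 0 (size (labels t))).
Proof.
rewrite /gnts /num labels_tmap labels_number.
elim: (labels t) 0 => //= -[p|a|i] l IH n /=; first by rewrite eqxx.
all: by apply: subseq_trans (IH _) (subseq_cons _ _).
Qed.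

Lemma num_fst_uniq (P : Type) (t : skel Sigma P) : uniq (map fst (gnts (num t))).
Proof. exact: subseq_uniq (num_fst t) (iota_uniq _ _). Qed.

Lemma num_fst_lt (P : Type) (t : skel Sigma P) :
  {in map fst (gnts (num t)), forall i, i < size (labels t)}.
Proof. by move=> i /(mem_subseq (num_fst t)); rewrite mem_iota. Qed.

Lemma gnts_num (P : Type) (t : skel Sigma P) : map snd (gnts (num t)) = gnts t.
Proof. by rewrite -gnts_smap tmap_snd_num. Qed.

Definition boolR : ralph := @RAlph bool nat_of_bool.

(** The root must be a hole, as in every result of [dec]; this allows reading off a nonterminal from
    the root of its instance. The limit on heights comes from [dec_height]. *)
Definition shapes (P theta : nat) : seq (stree boolR Sigma) :=
  [seq t <- trees_upto ([:: Nt true; Nt false] ++ [seq Tm a | a <- enum Sigma] ++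
                        [seq Var i | i <- iota 0 theta])
              (mr Sigma) theta.*2.+1 |
     (if t is Node (Nt _) _ then true else false) && (size (gnts t) <= P)].

Lemma mem_shapes P theta (t : stree boolR Sigma) k :
  0 < mr Sigma -> pattern k t -> k <= theta -> height t <= k.*2.+1 ->
  size (gnts t) <= P -> (exists b us, t = Node (Nt b) us) -> t \in shapes P theta.
Proof.
move=> m_gt0 /andP[rt vt] k_theta ht sz [b [us et]].
rewrite mem_filter {1}et sz andTb; apply: (mem_trees_upto (r := @sym_rk boolR Sigma)) => //.
- by case=> [[]|a|i] //=; rewrite leq_bigmax.
- move=> s; rewrite !mem_cat; case: s => [c|a|i] s_t; apply/orP.
  + by left; case: c {s_t}.
  + by right; rewrite map_f ?mem_enum.
  + right; apply/orP; right; apply: map_f.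
    have : i \in vars t by rewrite mem_pmap; apply/mapP; exists (Var i).
    by rewrite (perm_mem vt) !mem_iota /= !add0n => /leq_trans; apply.
- by apply: leq_trans ht _; rewrite ltnS leq_double.
Qed.

End Numbering.

(** * Values of derivations *)

Lemma all2_cat (A B : Type) (p : A -> B -> bool) s1 t1 s2 t2 :
  all2 p s1 t1 -> all2 p s2 t2 -> all2 p (s1 ++ s2) (t1 ++ t2).
Proof. by elim: s1 t1 => [|x s1 IH] [|y t1] //= /andP[-> /IH]. Qed.

Lemma all2_flatten_map (I : eqType) (A B : Type) (p : A -> B -> bool) (f : I -> seq A)
    (g : I -> seq B) (s : seq I) :
  {in s, forall i, all2 p (f i) (g i)} ->
  all2 p (flatten [seq f i | i <- s]) (flatten [seq g i | i <- s]).
Proof.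
elim: s => //= i s IH fg; apply: all2_cat; first exact/fg/mem_head.
by apply: IH => j js; apply: fg; rewrite in_cons js orbT.
Qed.

Lemma map_nth_index (A B : eqType) (d : B) (s : seq A) (t : seq B) :
  uniq s -> size t = size s -> [seq nth d t (index x s) | x <- s] = t.
Proof.
elim: s t => [|x s IH] [|y t] //= /andP[xs us] [sz]; rewrite eqxx /=; congr (_ :: _).
rewrite -[RHS](IH t us sz); apply/eq_in_map => z zs.
by case: eqP => // e; rewrite e zs in xs.
Qed.

Lemma all2_nthP (A B : Type) (p : A -> B -> bool) (a : A) (b : B) s t :
  all2 p s t <->
  size s = size t /\ forall i, i < size t -> p (nth a s i) (nth b t i).
Proof.
elim: s t => [|x s IH] [|y t] //=; try by split=> // -[].
split=> [/andP[pxy /IH[-> pst]]|[[sz] pst]]; first by split=> // -[|i] //=; exact: pst.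
apply/andP; split; first exact: (pst 0).
by apply/IH; split=> // i; exact: (pst i.+1).
Qed.

Lemma all2_flatten (A B : Type) (p : A -> B -> bool) (ss : seq (seq A)) (ts : seq (seq B)) :
  all2 (all2 p) ss ts -> all2 p (flatten ss) (flatten ts).
Proof. by elim: ss ts => [|s ss IH] [|t ts] //= /andP[st /IH]; exact: all2_cat. Qed.

Definition voidR : ralph := @RAlph void (fun _ => 0).

Section Values.
Variables (Sigma : ralph) (H : mcftg Sigma).

Definition rhs_of (r : rules H) (C : nt H) : stree (nt H) Sigma :=
  nth (Node (Var 0) [::]) (rhs r) (index C (lhs r)).

Lemma lhs_uniq (r : rules H) : uniq (lhs r).
Proof. exact: bignt_uniq (lhs_bignt r). Qed.

Lemma size_rhs (r : rules H) : size (rhs r) = size (lhs r).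
Proof. by have := rhs_pattern r; rewrite all2E => /andP[/eqP]. Qed.

Lemma rhsE (r : rules H) : rhs r = [seq rhs_of r C | C <- lhs r].
Proof. by rewrite map_nth_index // ?lhs_uniq ?size_rhs. Qed.

Lemma rhs_of_pattern (r : rules H) C : C \in lhs r -> pattern (rk C) (rhs_of r C).
Proof.
move=> C_r; have := rhs_pattern r; rewrite {1}rhsE; elim: (lhs r) C_r => //= D l IH.
by rewrite in_cons => /predU1P[->|/IH{}IH] /andP[] // _ /IH.
Qed.

Lemma rhs_of_nts (r : rules H) C : C \in lhs r -> {subset gnts (rhs_of r C) <= nts (rhs r)}.
Proof.
move=> C_r D D_C; rewrite ntsE; apply/flatten_mapP; exists (rhs_of r C) => //.
by rewrite rhsE map_f.
Qed.

Lemma perm_links (r : rules H) : perm_eq (flatten (links r)) (nts (rhs r)).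
Proof. by apply: uniq_perm (links_disj r) (rhs_uniq r) (links_cover r). Qed.

Lemma der_node (r : rules_alph H) ds A :
  der (Node r ds) A = (A == lhs (r : rules H)) && all2 (@der Sigma H) ds (links (r : rules H)).
Proof.
rewrite /=; congr (_ && _); move: (links _) => l.
by elim: ds l => [|d ds IH] [|B l] //=; rewrite IH.
Qed.

Lemma der_ranked d A : der d A -> ranked (@rk (rules_alph H)) d.
Proof.
elim/tree_indP: d A => r ds IH A; rewrite der_node => /andP[_] /=.
rewrite all2E => /andP[/eqP sz] e; rewrite sz eqxx /=.
elim: ds (links _) sz e IH => [|d ds IHd] [|B l] //= [sz] /andP[dB e] IH.
rewrite (IH d (mem_head _ _) _ dB) (IHd _ sz e) // => d' d'_ds; apply: IH.
by rewrite in_cons d'_ds orbT.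
Qed.

Definition env (ss : seq (nt H)) (vs : seq (stree voidR Sigma)) (n : nt H) :
  stree voidR Sigma := nth (Node (Var 0) [::]) vs (index n ss).

(* [dval] over the empty nonterminal alphabet, so that the values of
   derivations of different grammars live in the same type *)
Fixpoint cval (d : tree (rules_alph H)) : seq (stree voidR Sigma) :=
  let: Node r ds := d in
  [seq hsub (env (flatten (links (r : rules H))) (flatten [seq cval d' | d' <- ds])) t
     | t <- rhs (r : rules H)].

Definition env_ok (ss : seq (nt H)) (vs : seq (stree voidR Sigma)) : bool :=
  all2 (fun n t => pattern (rk n) t) ss vs.

Lemma env_pattern ss vs n : env_ok ss vs -> n \in ss -> pattern (rk n) (env ss vs n).
Proof.
move=> ok n_ss; have /all2_nthP : env_ok ss vs := ok.
move=> /(_ n (Node (Var 0) [::]))[sz /(_ (index n ss))].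
by rewrite nth_index // -sz index_mem n_ss; apply.
Qed.

Lemma map_env ss vs : uniq ss -> size vs = size ss -> map (env ss vs) ss = vs.
Proof. exact: map_nth_index. Qed.

Lemma env_map (F : nt H -> stree voidR Sigma) ss n : n \in ss -> env ss (map F ss) n = F n.
Proof. by move=> n_ss; rewrite /env (nth_map n) ?index_mem // nth_index. Qed.

Lemma cval_flatten ds l : all2 (@der Sigma H) ds l ->
  {in ds, forall d B, der d B -> env_ok B (cval d)} ->
  env_ok (flatten l) (flatten [seq cval d | d <- ds]).
Proof.
move=> dl IH; apply: all2_flatten; elim: ds l dl IH => [|d ds IHd] [|B l] //= /andP[dB dl] IH.
apply/andP; split; first exact: IH (mem_head _ _) _ dB.
by apply: IHd => // d' d'_ds; apply: IH; rewrite in_cons d'_ds orbT.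
Qed.

Lemma cval_ok d A : der d A -> env_ok A (cval d).
Proof.
elim/tree_indP: d A => r ds IH A; rewrite der_node => /andP[/eqP-> dl].
have ok := cval_flatten dl IH.
rewrite /= rhsE -map_comp; set h := env _ _ in ok *.
have : {subset lhs (r : rules H) <= lhs (r : rules H)} by [].
elim: {1 3 4}(lhs _) => //= C l IHl sub; apply/andP; split; last first.
  by apply: IHl => D D_l; apply: sub; rewrite in_cons D_l orbT.
have C_r := sub C (mem_head _ _); have /andP[rt vt] := rhs_of_pattern C_r.
apply: pattern_hsub rt _ vt => n n_C; apply: env_pattern ok _.
by rewrite links_cover; apply: rhs_of_nts n_C.
Qed.

Lemma cval_children_ok (r : rules_alph H) ds A : der (Node r ds) A ->
  env_ok (flatten (links (r : rules H))) (flatten [seq cval d | d <- ds]).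
Proof.
rewrite der_node => /andP[_ dl]; apply: cval_flatten => // d _ B; exact: cval_ok.
Qed.

Definition lift (t : stree voidR Sigma) : stree (nt H) Sigma :=
  hsub (of_void (stree (nt H) Sigma)) t.

(** Connects [subst], which stays in one alphabet, with [hsub], whose results here live over
    [voidR]. *)
Lemma subst_lift ss vs t : env_ok ss vs -> {subset gnts t <= ss} ->
  subst ss (map lift vs) t = lift (hsub (env ss vs) t).
Proof.
move=> ok; elim/tree_indP: t => s ts IH sub.
have IHts : [seq subst ss (map lift vs) u | u <- ts] =
            [seq lift (hsub (env ss vs) u) | u <- ts].
  apply/eq_in_map => u u_ts; apply: IH => // n n_u; apply: sub.
  by rewrite gnts_node mem_cat; apply/orP; right; apply/flatten_mapP; exists u.
case: s sub => [n|a|i] /= sub; rewrite IHts /lift /= -?map_comp //.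
have n_ss : n \in ss by apply: sub; rewrite gnts_node mem_head.
have /andP[rn _] := env_pattern ok n_ss.
rewrite n_ss (@hsub_vsubst _ voidR) -?map_comp //; congr vsubst.
have lt : index n ss < size vs.
  by have := ok; rewrite /env_ok all2E => /andP[/eqP <- _]; rewrite index_mem.
by rewrite (nth_map (Node (Var 0) [::])).
Qed.

Lemma dvalE d A : der d A -> dval d = map lift (cval d).
Proof.
elim/tree_indP: d A => r ds IH A dA; have ok := cval_children_ok dA.
move: dA; rewrite der_node => /andP[_ dl] /=.
have -> : flatten [seq dval d | d <- ds] = map lift (flatten [seq cval d | d <- ds]).
  rewrite map_flatten -map_comp; congr flatten; apply/eq_in_map => d d_ds /=.
  have [B dB] : exists B, der d B.
    elim: ds (links _) d_ds dl {IH ok} => [|d' ds IHd] [|B l] //=.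
    by rewrite in_cons => /predU1P[->|/IHd{}IHd] /andP[dB /IHd//]; exists B.
  exact: IH dB.
rewrite -map_comp; apply/eq_in_map => t t_r /=; apply: subst_lift => // n n_t.
by rewrite links_cover ntsE; apply/flatten_mapP; exists t.
Qed.

Lemma closed_tm (t : stree voidR Sigma) : gvars t = [::] -> exists t', t = tmap Tm t'.
Proof.
elim/tree_indP: t => s ts IH; rewrite gvars_node => e.
have [ts' ets] : exists ts', ts = map (tmap Tm) ts'.
  move: e; case: (oapp _ _ _) => //=.
  elim: ts IH => [|u ts IHts] IH /=; first by exists [::].
  case e: (gvars u) => [|//] /IHts[|ts' ->]; last first.
    by have [u' ->] := IH u (mem_head _ _) e; exists (u' :: ts').
  by move=> v v_ts; apply: IH; rewrite in_cons v_ts orbT.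
case: s e => [[]|a|i] //= _; by exists (Node a ts'); rewrite ets.
Qed.

Lemma lift_tm (t : tree Sigma) : lift (tmap Tm t) = tmap Tm t.
Proof.
elim/tree_indP: t => a ts IH; rewrite /lift /= -map_comp; congr Node.
exact/eq_in_map.
Qed.

Lemma cval_derivation d : derivation d -> exists t, cval d = [:: tmap Tm t].
Proof.
move=> /cval_ok; rewrite /env_ok; case: (cval d) => [//|t [|//]] /=; last first.
  by move=> ? ?; rewrite andbF.
rewrite start_rk andbT => /andP[_ vt]; have [|t' ->] := @closed_tm t; last by exists t'.
exact/size0nil/(perm_size vt).
Qed.

Lemma cval_yields d t : derivation d -> cval d = [:: tmap Tm t] -> yields d t.
Proof. by move=> /dvalE dE e; rewrite /yields dE e /= lift_tm. Qed.

End Values.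

(** * Relabelling transducers *)

Lemma regular_ranked (Omega : ralph) : regular (ranked (@rk Omega)).
Proof.
exists (@BTA Omega unit (fun _ _ => tt) setT) => t; rewrite inE.
by split=> [->|[]].
Qed.

Section Relabelling.
Variables (Omega Gamma : ralph) (X : finType) (a : X -> Omega) (b : X -> Gamma).
Variable la : X -> nat -> tree Omega -> Prop.
Hypothesis rk_ab : forall x, rk (a x) = rk (b x).
Hypothesis la_regular : forall x i, regular (la x i).
Hypothesis la_disjoint : forall x y, x <> y -> a x = a y ->
  exists2 i, i < rk (a x) & disjoint_langs (la x i) (la y i).

Definition relabel_out (x : X) : otree unit Gamma :=
  Node (inl (b x)) [seq Node (inr (tt, i)) [::] | i <- iota 0 (rk (a x))].

Lemma relabel_out_ranked x : ranked (@out_rk unit Gamma) (relabel_out x).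
Proof. by rewrite /= size_map size_iota rk_ab eqxx /= all_map; apply/allP. Qed.

Lemma yvars_relabel_out x : yvars (relabel_out x) = iota 0 (rk (a x)).
Proof. by rewrite /yvars /=; elim: (rk (a x)) 0 => //= n IH m; rewrite IH. Qed.

Lemma relabel_out_yvars x : all (fun i => i < rk (a x)) (yvars (relabel_out x)).
Proof. by rewrite yvars_relabel_out; apply/allP => i; rewrite mem_iota. Qed.

Lemma relabel_out_linear x : uniq (yvars (relabel_out x)).
Proof. by rewrite yvars_relabel_out iota_uniq. Qed.

(** There is one state, and the subtrees keep their order. The look-ahead at the node itself accepts
    all ranked trees, so determinism rests on the look-ahead at the children. *)
Definition relabelling : ldtr Omega Gamma :=
  @LDTR Omega Gamma unit tt X (fun=> tt) a (fun=> ranked (@rk Omega)) la relabel_out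
    (fun=> regular_ranked Omega) (fun x i _ => la_regular x i)
    relabel_out_ranked relabel_out_yvars relabel_out_linear
    (fun x y xy _ e => or_intror (la_disjoint xy e)).

Lemma relabelling_run x ts us (t0 : tree Omega) (u0 : tree Gamma) :
  size ts = rk (a x) -> size us = size ts -> all (ranked (@rk Omega)) ts ->
  (forall i, i < size ts -> la x i (nth t0 ts i)) ->
  (forall i, i < size ts -> @trun _ _ relabelling tt (nth t0 ts i) (nth u0 us i)) ->
  @trun _ _ relabelling tt (Node (a x) ts) (Node (b x) us).
Proof.
move=> szt szu rts la_ts run.
have -> : Node (b x) us = ysubst (fun _ i => nth u0 us i) (relabel_out x).
  by rewrite /= -map_comp -szt -szu; congr Node; rewrite -[LHS](mkseq_nth u0).
apply: (@Trun _ _ relabelling x ts) => //=.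
- by rewrite szt eqxx.
- by move=> i lt; rewrite (set_nth_default t0) //; exact: la_ts.
- move=> [] i; rewrite in_cons => /flatten_mapP[t /mapP[j j_a ->]] /=.
  rewrite inE => /eqP[->]; rewrite mem_iota in j_a.
  by rewrite (set_nth_default t0) ?szt //; apply: run; rewrite szt.
Qed.

End Relabelling.

(** * The monadic grammar *)

Lemma eq_map_inj (A : eqType) (B : Type) (f g : A -> B) (s t : seq A) :
  map f s = map g t -> (forall x y, x \in s -> y \in t -> f x = g y -> x = y) -> s = t.
Proof.
elim: s t => [|x s IH] [|y t] //= [e es] inj; congr (_ :: _).
  by apply: inj; rewrite ?mem_head.
by apply: IH => // z w z_s w_t; apply: inj; rewrite in_cons ?z_s ?w_t orbT.
Qed.

(** The argument of a variable that occurs can be recovered from the result; this makes the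
    unfolding of shapes injective. *)
Lemma vsubst_inj (N Sigma : ralph) (d : stree N Sigma) us us' (t : stree N Sigma) :
  size us = size us' -> ranked (srk (@rk N)) t -> vsubst us t = vsubst us' t ->
  {in gvars t, forall i, i < size us -> nth d us i = nth d us' i}.
Proof.
move=> sz; elim/tree_indP: t => s ts IH /= /andP[szs rts] e i.
have main : [seq vsubst us u | u <- ts] = [seq vsubst us' u | u <- ts] ->
    i \in flatten [seq gvars u | u <- ts] -> i < size us -> nth d us i = nth d us' i.
  move=> /eq_in_map e' /flatten_mapP[u u_ts i_u].
  by apply: IH (u_ts) (allP rts u u_ts) _ _ i_u; exact: e'.
rewrite gvars_node; case: s szs e => [n|a|j] /= szs e; try by case: e => /main.
move: szs => /nilP ts0; rewrite ts0 inE => /eqP -> lt.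
by rewrite ts0 in e; rewrite (set_nth_default (Node (Var j) [::])) // e
  (set_nth_default d) // -sz.
Qed.

Lemma height_tmap (A B : Type) (f : A -> B) t : height (tmap f t) = height t.
Proof.
move: t; fix IH 1; case=> a ts /=; congr S; rewrite !big_map.
by elim: ts => [|t ts]; rewrite ?big_nil // !big_cons IH => ->.
Qed.

Section Construction.
Variables (Sigma : ralph) (G : mcftg Sigma).
Hypothesis width_ge2 : 2 <= width G.

Let m_gt0 : 0 < mr Sigma := mr_gt0 G.

Definition piece_bound := (2 * width G - 1) * mr Sigma.

Definition all_shapes : seq (stree boolR Sigma) := shapes Sigma piece_bound (width G).

(** The shape of closed trees, and the default wherever no shape is guessed. *)
Definition trivial_shape : stree boolR Sigma := Node (Nt false) [::].

Lemma trivial_shape_in : trivial_shape \in all_shapes.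
Proof.
apply: (mem_shapes (k := 0)) => //=; first by rewrite big_nil.
  by rewrite /piece_bound; change (0 < (2 * width G - 1) * mr Sigma); rewrite muln_gt0; lia.
by exists false, [::].
Qed.

Definition shape_id : finType := seq_sub all_shapes.
Definition sid0 : shape_id := SeqSub trivial_shape_in.
(** Bounds all hole numbers, so that [inord] in [piece_name] loses nothing. *)
Definition max_labels := \max_(s <- all_shapes) size (labels s).

(* The nonterminal [(C, i, (j, b))] generates the piece with number [j], of
   rank [b], of the patterns of shape [i] generated by [C]. *)
Definition piece_nt : ralph :=
  @RAlph (nt G * shape_id * ('I_max_labels.+1 * bool))%type (fun n => n.2.2 : nat).

Lemma piece_nt_monadic (n : piece_nt) : rk n <= 1.
Proof. by case: n => [? [? []]]. Qed.

Definition piece_name (C : nt G) (i : shape_id) (x : nat * bool) : piece_nt :=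
  (C, i, (inord x.1, x.2)).

Definition inst (C : nt G) (i : shape_id) : stree piece_nt Sigma :=
  tmap (smap (piece_name C i)) (num (val i)).

Lemma gnts_inst C i : gnts (inst C i) = [seq piece_name C i x | x <- gnts (num (val i))].
Proof. exact: gnts_smap. Qed.

Lemma mem_inst C i n : n \in gnts (inst C i) -> n.1 = (C, i).
Proof. by rewrite gnts_inst => /mapP[x _ ->]. Qed.

Lemma inst_root C i : exists n us, inst C i = Node (Nt n) us /\ n.1 = (C, i).
Proof.
have : val i \in all_shapes := valP i.
rewrite mem_filter /inst => /andP[/andP[]].
case: (val i) => -[b|//|//] us _ _ _; rewrite /num /=.
by eexists; eexists; split; first reflexivity.
Qed.

Lemma inst_head C i : exists2 n, n \in gnts (inst C i) & n.1 = (C, i).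
Proof.
have [n [us [e ni]]] := inst_root C i.
by exists n => //; rewrite e gnts_node mem_head.
Qed.

Lemma uniq_inst C i : uniq (gnts (inst C i)).
Proof.
rewrite gnts_inst map_inj_in_uniq; first exact: map_uniq (num_fst_uniq _).
have le_max (s : stree boolR Sigma) : s \in all_shapes -> size (labels s) <= max_labels.
  by move=> s_in; apply: (@leq_bigmax_seq _ all_shapes xpredT (fun s => size (labels s))).
move=> [a b] [c d] /(map_f fst)/num_fst_lt /= lt_a /(map_f fst)/num_fst_lt /= lt_c.
have le_i := le_max _ (valP i).
case=> /(congr1 val) /=; rewrite !inordK; first by move=> -> ->.
all: by rewrite ltnS; apply: leq_trans le_i; apply: ltnW.
Qed.

Lemma pattern_inst C i k : pattern k (val i) -> pattern k (inst C i).
Proof.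
rewrite !patternE /inst gvars_smap.
rewrite -{1 2}[val i]tmap_snd_num gvars_smap ranked_smap.
by move=> /andP[r ->]; rewrite andbT (ranked_smap (piece_name C i)).
Qed.

(** * Big nonterminals made of piece names *)

Definition names (g : nt G -> shape_id) (B : seq (nt G)) : seq piece_nt :=
  flatten [seq gnts (inst C (g C)) | C <- B].

Lemma mem_names g B n :
  n \in names g B -> [/\ n.1.1 \in B, n.1.2 = g n.1.1 & n \in gnts (inst n.1.1 (g n.1.1))].
Proof.
by move=> /flatten_mapP[C CB n_C]; rewrite (mem_inst n_C) /=.
Qed.

Lemma names_flatten g Bs : names g (flatten Bs) = flatten [seq names g B | B <- Bs].
Proof. by elim: Bs => //= B Bs <-; rewrite /names map_cat flatten_cat. Qed.

Lemma eq_in_names g g' B : {in B, g =1 g'} -> names g B = names g' B.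
Proof. by move=> e; congr flatten; apply/eq_in_map => C CB; rewrite e. Qed.

Lemma uniq_names g B : uniq B -> uniq (names g B).
Proof.
elim: B => //= C B IH /andP[CB uB]; rewrite cat_uniq uniq_inst (IH uB) andbT /=.
apply/hasPn => n /mem_names[nB _ _]; apply: contraNN CB => /mem_inst e.
by rewrite e in nB.
Qed.

Lemma perm_names g B B' : perm_eq B B' -> perm_eq (names g B) (names g B').
Proof. by move=> e; apply: perm_flatten; apply: perm_map. Qed.

(** Each name carries its nonterminal and its shape, and every instance has at least one hole. *)
Lemma names_sub g g' B B' : {subset names g B <= names g' B'} ->
  {subset B <= B'} /\ {in B, g =1 g'}.
Proof.
move=> sub.
have main C : C \in B -> C \in B' /\ g C = g' C.
  move=> CB; have [n n_C e] := inst_head C (g C).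
  have /sub/mem_names[] : n \in names g B by apply/flatten_mapP; exists C.
  by rewrite e.
by split=> C /main[].
Qed.

Lemma names_eqi g g' B B' : names g B =i names g' B' -> B =i B' /\ {in B, g =1 g'}.
Proof.
move=> e; have [|s1 gg] := @names_sub g g' B B' _; first by move=> n; rewrite e.
have [|s2 _] := @names_sub g' g B' B _; first by move=> n; rewrite e.
by split=> // C; apply/idP/idP; [apply: s1 | apply: s2].
Qed.

Lemma names_neq0 g B : B != [::] -> names g B != [::].
Proof.
case: B => // C B _; have [n n_C _] := inst_head C (g C).
by rewrite /names /=; case: (gnts _) n_C.
Qed.

Lemma size_names g B : size (names g B) <= size B * piece_bound.
Proof.
elim: B => //= C B IH; rewrite /names /= size_cat mulSn; apply: leq_add => //.
rewrite gnts_inst size_map -(size_map snd) gnts_num.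
by have := valP (g C); rewrite mem_filter => /andP[/andP[_]].
Qed.

(** * Rules with guessed shapes *)

Definition cfg : finType := {ffun nt G -> shape_id}.

(** Outside the right-hand side the guess is fixed to [sid0]; otherwise several indices would
    describe the same rule, against [rules_inj]. *)
Definition okrule (x : rules G * cfg) : bool :=
  [forall C, if C \in nts (rhs x.1) then pattern (rk C) (val (x.2 C)) else x.2 C == sid0].

Definition unfold_rhs (g : cfg) (t : stree (nt G) Sigma) : stree piece_nt Sigma :=
  hsub (fun C => inst C (g C)) t.

Definition shape (t : stree piece_nt Sigma) : stree boolR Sigma :=
  tmap (smap (@hasvar piece_nt Sigma)) (dec t).

Lemma shape_pattern t k : pattern k t -> pattern k (shape t).
Proof.
rewrite !patternE => /andP[rt vt]; rewrite /shape ranked_smap gvars_smap.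
have [rd wd e] := dec_correct piece_nt_monadic rt.
rewrite rd /=; apply: perm_trans vt; rewrite perm_sym -{1}e.
exact: gvars_hsub rd wd.
Qed.

Lemma shape_in t k : pattern k t -> k <= width G -> shape t \in all_shapes.
Proof.
move=> pt k_w; have /andP[rt vt] := pt.
have sv : size (gvars t) = k by rewrite (perm_size vt) size_iota.
apply: (mem_shapes (k := k)) => //; first exact: shape_pattern.
- by rewrite height_tmap -sv; exact: dec_height piece_nt_monadic _ rt.
- rewrite gnts_smap size_map; apply: leq_trans (dec_size piece_nt_monadic m_gt0 rt) _.
  rewrite sv geq_max /piece_bound muln_gt0 m_gt0 leq_mul2r.
  by apply/andP; split; [lia | apply/orP; right; rewrite -mul2n; lia].
- by have [p [us e]] := dec_root t; rewrite /shape e; eexists; eexists.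
Qed.

(** [insubd] makes [post] total, as the look-ahead automaton requires; by [val_post] its default is
    not taken when the guesses are admissible. *)
Definition post (r : rules G) (g : cfg) : cfg :=
  [ffun C => if C \in lhs r then insubd sid0 (shape (unfold_rhs g (rhs_of r C))) else sid0].

Section Rule.
Variables (r : rules G) (g : cfg).
Hypothesis ok : okrule (r, g).

Lemma okrule_pattern C : C \in nts (rhs r) -> pattern (rk C) (val (g C)).
Proof. by move=> C_r; move/forallP/(_ C): ok; rewrite C_r. Qed.

Lemma wf_inst C : C \in lhs r -> wf_env (@rk (nt G)) (fun D => inst D (g D)) (rhs_of r C).
Proof.
by move=> C_r D D_C; apply: pattern_inst; apply: okrule_pattern; apply: rhs_of_nts D_C.
Qed.

Lemma unfold_rhs_pattern C : C \in lhs r -> pattern (rk C) (unfold_rhs g (rhs_of r C)).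
Proof.
move=> C_r; have /andP[rt vt] := rhs_of_pattern C_r.
exact: pattern_hsub rt (wf_inst C_r) vt.
Qed.

Lemma unfold_rhs_ranked C : C \in lhs r -> ranked (srk (@rk piece_nt)) (unfold_rhs g (rhs_of r C)).
Proof. by move=> /unfold_rhs_pattern/andP[]. Qed.

Lemma val_post C : C \in lhs r -> val (post r g C) = shape (unfold_rhs g (rhs_of r C)).
Proof.
move=> C_r; rewrite ffunE C_r insubdK //.
apply: shape_in (unfold_rhs_pattern C_r) _; exact: leq_bigmax.
Qed.

Lemma post_pattern C : C \in lhs r -> pattern (rk C) (val (post r g C)).
Proof. by move=> C_r; rewrite val_post //; apply: shape_pattern; apply: unfold_rhs_pattern. Qed.

Lemma post_out C : C \notin lhs r -> post r g C = sid0.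
Proof. by move=> /negPf C_r; rewrite ffunE C_r. Qed.

Definition pieces : seq (stree piece_nt Sigma) :=
  flatten [seq gnts (dec (unfold_rhs g (rhs_of r C))) | C <- lhs r].

(** By definition of [post], the holes of the instance are the pieces of the cut right-hand side, in
    the same order and with their ranks. *)
Lemma pieces_pattern :
  all2 (fun n t => pattern (rk n) t) (names (post r g) (lhs r)) pieces.
Proof.
apply: all2_flatten_map => C C_r.
rewrite gnts_inst val_post // /shape num_smap gnts_smap -map_comp.
have [_ wd _] := dec_correct piece_nt_monadic (unfold_rhs_ranked C_r).
move: wd; rewrite /wf_env -[gnts (dec _)]gnts_num.
elim: (gnts (num _)) => //= x l IH wd; rewrite wd ?mem_head //=.
by apply: IH => p p_l; apply: wd; rewrite in_cons p_l orbT.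
Qed.

(** Unfolding replaces each nonterminal by its names, and cutting only redistributes the symbols;
    both are cases of [gnts_hsub]. *)
Lemma nts_pieces : perm_eq (nts pieces) (names g (nts (rhs r))).
Proof.
rewrite !ntsE [in X in perm_eq _ X]rhsE /pieces -map_comp.
elim: (lhs r) (fun C => @wf_inst C) (fun C => @unfold_rhs_ranked C)
  (fun C => @rhs_of_pattern _ _ r C) => //= C l IH wf er pt.
rewrite map_cat flatten_cat /names map_cat flatten_cat; apply: perm_cat; last first.
  by apply: IH => D D_l; [apply: wf | apply: er | apply: pt]; rewrite in_cons D_l orbT.
have [rd wd e] := dec_correct piece_nt_monadic (er C (mem_head _ _)).
have := gnts_hsub rd wd; rewrite e perm_sym => /perm_trans; apply.
by have /andP[rt _] := pt C (mem_head _ _); exact: gnts_hsub rt (wf C (mem_head _ _)).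
Qed.

(* What makes the decomposition compatible with values: interpreting the names
   by what the pieces are mapped to interprets the whole pattern. *)
Lemma hsub_post (N2 : ralph) (f : piece_nt -> stree N2 Sigma)
    (h : stree piece_nt Sigma -> stree N2 Sigma) :
  map f (names (post r g) (lhs r)) = map h pieces ->
  {in lhs r, forall C, hsub f (inst C (post r g C)) = hsub h (dec (unfold_rhs g (rhs_of r C)))}.
Proof.
rewrite !map_flatten -!map_comp => e C C_r.
have {e} : [seq f n | n <- gnts (inst C (post r g C))] =
           [seq h p | p <- gnts (dec (unfold_rhs g (rhs_of r C)))].
  (* For each [C] there are as many holes as pieces, so the equation of concatenations splits into
     blocks. *)
  move: C C_r; apply/eq_in_map; apply: eq_from_flatten_shape e _.
  rewrite /seq.shape -!map_comp; apply/eq_in_map => D D_r /=; rewrite !size_map.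
  by rewrite gnts_inst size_map val_post // /shape num_smap gnts_smap size_map
    -[in RHS]gnts_num size_map.
rewrite gnts_inst val_post // /shape num_smap gnts_smap -[gnts (dec _)]gnts_num -!map_comp.
move/eq_in_map => e.
(* Both sides become the same numbered cut tree, under interpretations that agree on its numbered
   pieces. *)
rewrite /inst val_post // /shape num_smap -[in RHS](tmap_snd_num (dec _)) !hsub_smap.
exact: eq_in_hsub e.
Qed.

End Rule.

(** * Components of the new grammar and their side conditions *)

Definition new_rule := {x : rules G * cfg | okrule x}.

Definition old (x : new_rule) : rules G := (val x).1.
Definition before (x : new_rule) : cfg := (val x).2.
Definition after (x : new_rule) : cfg := post (old x) (before x).

Lemma new_ok (x : new_rule) : okrule (old x, before x).
Proof. by rewrite -surjective_pairing; exact: valP x. Qed.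

Lemma before_out (x : new_rule) C : C \notin nts (rhs (old x)) -> before x C = sid0.
Proof. by move=> /negPf C_x; have /forallP/(_ C) := new_ok x; rewrite C_x => /eqP. Qed.

Definition new_start : piece_nt := piece_name (start G) sid0 (0, false).

Definition new_bignt : seq (seq piece_nt) :=
  [seq names g B | B <- bignt G, g : cfg <- enum cfg].

Definition new_lhs (x : new_rule) := names (after x) (lhs (old x)).
Definition new_rhs (x : new_rule) := pieces (old x) (before x).
Definition new_links (x : new_rule) := [seq names (before x) B | B <- links (old x)].

Lemma mem_new_bignt (g : cfg) B : B \in bignt G -> names g B \in new_bignt.
Proof. by move=> B_G; apply/allpairsP; exists (B, g); rewrite mem_enum. Qed.

Lemma new_bigntP A : A \in new_bignt ->
  exists B (g : cfg), B \in bignt G /\ A = names g B.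
Proof. by move=> /allpairsP[[B g] [B_G _ ->]]; exists B, g. Qed.

Lemma names_start g : g (start G) = sid0 -> names g [:: start G] = [:: new_start].
Proof. by move=> e; rewrite /names /= e. Qed.

Lemma names_eq (g g' : cfg) B B' : B \in bignt G -> B' \in bignt G ->
  names g B =i names g' B' -> B = B' /\ {in B, g =1 g'}.
Proof.
by move=> B_G B'_G /names_eqi[e gg]; split=> //; exact: bignt_occ.
Qed.

Lemma flatten_new_links x : flatten (new_links x) = names (before x) (flatten (links (old x))).
Proof. by rewrite names_flatten. Qed.

(** The initial nonterminal has rank 0, so its unfolded right-hand side is closed and forms a single
    piece. *)
Lemma lhs_start_after x : [:: start G] = lhs (old x) -> after x (start G) = sid0.
Proof.
move=> e; apply: val_inj; rewrite val_post ?new_ok -?e ?mem_head //.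
have := unfold_rhs_pattern (new_ok x) (C := start G); rewrite -e mem_head => /(_ isT).
rewrite start_rk => /andP[rt vt].
have {vt} : gvars (unfold_rhs (before x) (rhs_of (old x) (start G))) = [::].
  by have := perm_size vt => /= /size0nil.
rewrite /shape; case: (unfold_rhs _ _) => s ts e0; rewrite [dec _]/= /hasvar e0 /=.
by rewrite /hasvar e0.
Qed.

Lemma new_bignt_neq0 A : A \in new_bignt -> A != [::].
Proof. by move=> /new_bigntP[B [g [/bignt_neq0 B0 ->]]]; exact: names_neq0. Qed.

Lemma new_bignt_uniq A : A \in new_bignt -> uniq A.
Proof. by move=> /new_bigntP[B [g [/bignt_uniq Bu ->]]]; exact: uniq_names. Qed.

Lemma new_bignt_occ A A' :
  A \in new_bignt -> A' \in new_bignt -> A =i A' -> A = A'.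
Proof.
move=> /new_bigntP[B [g [B_G ->]]] /new_bigntP[B' [g' [B'_G ->]]] e.
have [<- gg] := names_eq B_G B'_G e; exact: eq_in_names.
Qed.

Lemma new_start_bignt : [:: new_start] \in new_bignt.
Proof.
rewrite -(names_start (g := [ffun _ => sid0] : cfg)) ?ffunE //.
exact: mem_new_bignt (start_bignt G).
Qed.

(** The root hole of an instance reveals the nonterminal and its shape, and an instance of the right
    rank contains every argument; so [t] can be read off from the top down. *)
Lemma unfold_rhs_inj (g g' : cfg) (t t' : stree (nt G) Sigma) :
  ranked (srk (@rk (nt G))) t -> ranked (srk (@rk (nt G))) t' ->
  {in gnts t, forall C, pattern (rk C) (val (g C))} ->
  {in gnts t', forall C, pattern (rk C) (val (g' C))} ->
  unfold_rhs g t = unfold_rhs g' t' -> t = t'.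
Proof.
elim/tree_indP: t t' => s ts IH [s' ts'] /= /andP[sz rts] /andP[sz' rts'] pg pg'.
have main : [seq unfold_rhs g u | u <- ts] = [seq unfold_rhs g' u | u <- ts'] -> ts = ts'.
  move=> e; apply: eq_map_inj e _ => u u' u_ts u'_ts' e; apply: IH e => //.
  - exact: (allP rts).
  - exact: (allP rts').
  - move=> C C_u; apply: pg; rewrite gnts_node mem_cat; apply/orP; right.
    by apply/flatten_mapP; exists u.
  - move=> C C_u; apply: pg'; rewrite gnts_node mem_cat; apply/orP; right.
    by apply/flatten_mapP; exists u'.
rewrite /unfold_rhs /= -/(unfold_rhs g) -/(unfold_rhs g').
case: s sz pg => [C|a|i] /= sz pg; case: s' sz' pg' => [C'|a'|i'] /= sz' pg'.
- have [n [us [en eC]]] := inst_root C (g C); have [n' [us' [en' eC']]] := inst_root C' (g' C').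
  move=> e; have enn : n = n' by move: e; rewrite en en' => -[->].
  move: eC' sz' e; rewrite -enn eC => -[<- <-] sz' e.
  have /(pattern_inst C)/andP[rI vI] : pattern (rk C) (val (g C)).
    by apply: pg; rewrite gnts_node mem_head.
  have szs : size ts = size ts' by rewrite (eqP sz) (eqP sz').
  congr Node; apply: main.
  (* Arguments are compared by position; each position below the rank occurs as a variable of the
     instance. *)
  apply: (@eq_from_nth _ (Node (Var 0) [::])) => [|k]; rewrite !size_map // => lt.
  have := vsubst_inj (Node (Var 0) [::]) _ rI e; apply; rewrite ?size_map //.
  by rewrite (perm_mem vI) mem_iota -(eqP sz).
- have [n [us [-> _]]] := inst_root C (g C); by [].
- have [n [us [-> _]]] := inst_root C (g C); by [].
- have [n [us [-> _]]] := inst_root C' (g' C'); by [].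
- by case=> -> /main->.
- by [].
- have [n [us [-> _]]] := inst_root C' (g' C'); by [].
- by [].
- by case=> -> /main->.
Qed.

(** Left-hand side and links are recovered from the names, the right-hand side by gluing the pieces
    and undoing the unfolding; outside the links both guesses are [sid0]. *)
Lemma new_rules_inj (x y : new_rule) :
  new_lhs x = new_lhs y -> new_rhs x = new_rhs y -> new_links x =i new_links y -> x = y.
Proof.
move=> el er ek.
have [elhs eafter] : lhs (old x) = lhs (old y) /\ {in lhs (old x), after x =1 after y}.
  by apply: names_eq; rewrite ?lhs_bignt // -/(new_lhs x) el.
have ebefore B : B \in links (old x) -> B \in links (old y) /\ {in B, before x =1 before y}.
  move=> B_x; have : names (before x) B \in new_links x by exact: map_f.
  rewrite ek => /mapP[B' B'_y e].
  have [|-> ] := @names_eq (before x) (before y) B B' (links_bignt B_x) (links_bignt B'_y).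
    by rewrite e.
  by [].
have elinks : links (old x) =i links (old y).
  move=> B; apply/idP/idP => [/ebefore[]//|B_y].
  have : names (before y) B \in new_links y by exact: map_f.
  rewrite -ek => /mapP[B' B'_x e].
  have [|-> //] := @names_eq (before y) (before x) B B' (links_bignt B_y) (links_bignt B'_x).
  by rewrite e.
have erhs C : C \in lhs (old x) -> rhs_of (old x) C = rhs_of (old y) C.
  move=> C_x; have C_y : C \in lhs (old y) by rewrite -elhs.
  (* [f] sends each name on the left to its piece, so [hsub_post] glues the pieces of both rules. *)
  pose f n := nth (x0 piece_nt Sigma) (new_rhs x) (index n (new_lhs x)).
  have sz z : size (new_rhs z) = size (new_lhs z).
    by have := pieces_pattern (new_ok z); rewrite all2E => /andP[/eqP].
  have ul z : uniq (new_lhs z) by apply: uniq_names; apply: lhs_uniq.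
  have fx : map f (new_lhs x) = map id (new_rhs x) by rewrite map_id map_nth_index.
  have fy : map f (new_lhs y) = map id (new_rhs y) by rewrite map_id -el -er map_nth_index.
  have := hsub_post (new_ok x) fx C_x; have := hsub_post (new_ok y) fy C_y.
  rewrite -/(after x) -/(after y) eafter // => ->.
  have [_ _ ->] := dec_correct piece_nt_monadic (unfold_rhs_ranked (new_ok x) C_x).
  have [_ _ ->] := dec_correct piece_nt_monadic (unfold_rhs_ranked (new_ok y) C_y).
  move/esym/unfold_rhs_inj; apply => [||D D_C|D D_C].
  - by have /andP[] := rhs_of_pattern C_x.
  - by have /andP[] := rhs_of_pattern C_y.
  - by apply: okrule_pattern (new_ok x) _ _; apply: rhs_of_nts D_C.
  - by apply: okrule_pattern (new_ok y) _ _; apply: rhs_of_nts D_C.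
have eold : old x = old y.
  by apply: rules_inj => //; rewrite !rhsE -elhs; apply/eq_in_map.
apply: val_inj; rewrite [val x]surjective_pairing [val y]surjective_pairing.
congr pair; first exact: eold.
apply/ffunP => C; have [C_x|C_x] := boolP (C \in nts (rhs (old x))).
  move: (C_x); rewrite -links_cover => /flattenP[B /ebefore[_ eB] C_B]; exact: eB.
by rewrite -/(before x) -/(before y) !before_out // -eold.
Qed.

Lemma new_rhs_uniq x : uniq (nts (new_rhs x)).
Proof. by rewrite (perm_uniq (nts_pieces (new_ok x))); apply: uniq_names; exact: rhs_uniq. Qed.

Lemma new_links_bignt x : {subset new_links x <= new_bignt}.
Proof. by move=> _ /mapP[B /links_bignt B_x ->]; exact: mem_new_bignt. Qed.

Lemma new_links_disj x : uniq (flatten (new_links x)).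
Proof. by rewrite flatten_new_links; apply: uniq_names; exact: links_disj. Qed.

Lemma new_links_cover x : flatten (new_links x) =i nts (new_rhs x).
Proof.
rewrite flatten_new_links; apply: perm_mem; rewrite perm_sym.
apply: perm_trans (nts_pieces (new_ok x)) _; rewrite perm_sym.
exact: perm_names (perm_links _).
Qed.

Lemma new_start_separated x : new_start \notin nts (new_rhs x).
Proof.
rewrite (perm_mem (nts_pieces (new_ok x))).
by apply/negP => /mem_names[/=]; rewrite (negPf (start_separated _)).
Qed.

Definition monadic_form : mcftg Sigma :=
  @MCFTG Sigma piece_nt new_bignt new_start new_rule new_lhs new_rhs new_links
    m_gt0 new_bignt_neq0 new_bignt_uniq new_bignt_occ new_start_bignt (erefl 0)
    new_rules_inj (fun x => mem_new_bignt (after x) (lhs_bignt (old x)))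
    (fun x => pieces_pattern (new_ok x)) new_rhs_uniq new_links_bignt new_links_disj
    new_links_cover new_start_separated.

(** * Width, multiplicity and lexicalization *)

Lemma monadic_form_monadic : monadic monadic_form.
Proof. by apply/bigmax_leqP => n _; exact: piece_nt_monadic. Qed.

Lemma monadic_form_multiplicity :
  multiplicity monadic_form <= multiplicity G * piece_bound.
Proof.
apply/bigmax_leqP_seq => A /new_bigntP[B [g [B_G ->]]] _.
apply: leq_trans (size_names g B) _; rewrite leq_mul2r.
by apply/orP; right; exact: (@leq_bigmax_seq _ (bignt G) xpredT size).
Qed.

(** Unfolding keeps the terminals of the old right-hand side, and by [dec_tms] a symbol of rank 0
    never stays outside the pieces. *)
Lemma monadic_form_lexicalized (Delta : {set Sigma}) :
  (forall a, a \in Delta -> rk a = 0) -> lexicalized G Delta ->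
  lexicalized monadic_form Delta.
Proof.
move=> Delta0 lexG x px.
have /lexG : Defs.proper (old x).
  (* An initial terminal old rule gives an initial terminal new rule, as its left-hand side receives
     the trivial shape. *)
  apply: contraNN px => /andP[/eqP ini /eqP ter]; apply/andP; split.
    rewrite /initial /= /new_lhs ini names_start //; exact: lhs_start_after.
  by rewrite /terminal /= /new_links ter.
case/hasP => a; rewrite tmsE rhsE -map_comp => /flatten_mapP[C C_x /= a_C] a_Delta.
have [/andP[rt _] wf] := (rhs_of_pattern C_x, wf_inst (new_ok x) C_x).
have rT := unfold_rhs_ranked (new_ok x) C_x.
have : a \in gtms (unfold_rhs (before x) (rhs_of (old x) C)).
  by rewrite (perm_mem (gtms_hsub rt wf)) mem_cat a_C.
have [rd wd e] := dec_correct piece_nt_monadic rT.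
rewrite -{1}e (perm_mem (gtms_hsub rd wd)) mem_cat => /orP[a_d|].
  by have := dec_tms piece_nt_monadic rT a_d; rewrite Delta0.
case/flatten_mapP => p p_C a_p; apply/hasP; exists a => //.
rewrite tmsE; apply/flatten_mapP; exists p => //.
by apply/flatten_mapP; exists C.
Qed.

(** * Equivalence *)

Local Notation G' := monadic_form.

Definition forget : tree (rules_alph G') -> tree (rules_alph G) :=
  tmap (fun x : rules_alph G' => old x : rules_alph G).

(** The induction step of [forget_correct] for all links at once: the environment of the
    concatenated links is cut into one block for each link. *)
Lemma new_links_children x (ds : seq (tree (rules_alph G'))) :
  all2 (@der Sigma G') ds (new_links x) ->
  {in ds, forall d (g : cfg) B, B \in bignt G -> @der Sigma G' d (names g B) ->
     der (forget d) B /\ forall f, map f (names g B) = @cval Sigma G' d ->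
       cval (forget d) = [seq hsub f (inst C (g C)) | C <- B]} ->
  let f := @env Sigma G' (flatten (new_links x)) (flatten [seq cval d | d <- ds]) in
  all2 (@der Sigma G) (map forget ds) (links (old x)) /\
  flatten [seq cval (forget d) | d <- ds] =
    [seq hsub f (inst C (before x C)) | C <- flatten (links (old x))].
Proof.
move=> dl IH f.
have [ok sz] : @env_ok Sigma G' (flatten (new_links x)) (flatten [seq cval d | d <- ds]) /\
    size ds = size (new_links x).
  by split; [apply: cval_flatten => // d _ B; exact: cval_ok
            | move: dl; rewrite all2E => /andP[/eqP]].
have ef : [seq map f L | L <- new_links x] = [seq cval d | d <- ds].
  apply: eq_from_flatten_shape.
    rewrite -map_flatten map_env //; first exact: new_links_disj.
    by move: ok; rewrite /env_ok all2E => /andP[/eqP].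
  move: dl; clearbody f; move: (new_links x) => l {IH ok sz}; rewrite /seq.shape -!map_comp.
  elim: ds l => [|d ds IHd] [|L l] //=; move=> /andP[/cval_ok dL /IHd ->].
  by move: dL; rewrite /env_ok all2E size_map => /andP[/eqP->].
have : {subset links (old x) <= bignt G} by apply: links_bignt.
move: ef dl IH; rewrite /new_links; clearbody f; move: (links _) => l {ok sz}.
elim: ds l => [|d ds IHd] [|B l] //= [eB ef] /andP[dB dl] IH sub.
have [dB' eB'] := IH d (mem_head _ _) _ B (sub B (mem_head _ _)) dB.
have [||-> ->] := IHd l ef dl.
- by move=> d' d'_ds; apply: IH; rewrite in_cons d'_ds orbT.
- by move=> B' B'_l; apply: sub; rewrite in_cons B'_l orbT.
by rewrite dB' map_cat (eB' f eB).
Qed.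

(** Gluing the values of the pieces along the guessed shapes gives the value of the old derivation.
    Leaving [f] arbitrary lets one environment for all links serve each of them. *)
Lemma forget_correct (d : tree (rules_alph G')) (g : cfg) B :
  B \in bignt G -> @der Sigma G' d (names g B) ->
  der (forget d) B /\ forall f, map f (names g B) = @cval Sigma G' d ->
    cval (forget d) = [seq hsub f (inst C (g C)) | C <- B].
Proof.
elim/tree_indP: d g B => x ds IH g B B_G d_B; have ok := cval_children_ok d_B.
move: d_B; rewrite der_node => /andP[/eqP e dl].
have [eB eg] : B = lhs (old x) /\ {in B, g =1 after x}.
  by apply: names_eq => //; [exact: lhs_bignt | rewrite e].
have [dl' ecv] := new_links_children dl IH.
split; first by rewrite der_node eB eqxx.
move=> f ef; set F := env _ _ in ecv; rewrite -/F in ef.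
rewrite /= -map_comp ecv eB rhsE -map_comp; apply/eq_in_map => C C_r /=.
have [/andP[rt _] wf] := (rhs_of_pattern C_r, wf_inst (new_ok x) C_r).
have F_vars n : n \in flatten (new_links x) -> all (fun i => i < rk n) (gvars (F n)).
  by move=> n_l; apply: pattern_vars; exact: env_pattern ok n_l.
have in_links D : D \in gnts (rhs_of (old x) C) -> D \in flatten (links (old x)).
  by move=> D_C; rewrite links_cover; apply: rhs_of_nts D_C.
(* The middle term is the unfolded right-hand side: [hsub_comp] moves [F] first through the
   unfolding of the guessed shapes, then through the cutting into pieces. *)
transitivity (hsub F (unfold_rhs (before x) (rhs_of (old x) C))).
  rewrite hsub_comp => [|D /wf/andP[]//|D D_C n n_D]; last first.
    apply: F_vars; rewrite flatten_new_links; apply/flatten_mapP; exists D => //.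
    exact: in_links.
  by apply: eq_in_hsub => D /in_links D_l; rewrite env_map.
have rT := unfold_rhs_ranked (new_ok x) C_r.
have [rd wd eT] := dec_correct piece_nt_monadic rT.
rewrite -{1}eT hsub_comp => [|p /wd/andP[]//|p p_C n n_p]; last first.
  apply: F_vars; rewrite new_links_cover ntsE; apply/flatten_mapP; exists p => //.
  by apply/flatten_mapP; exists C.
have e_pieces : map f (names (after x) (lhs (old x))) = map (hsub F) (new_rhs x).
  by transitivity (map f (names g B)); [rewrite e | exact: ef].
by rewrite eg ?eB //; rewrite (hsub_post (new_ok x) e_pieces C_r).
Qed.

(** The trivial shape is one hole of rank 0, so gluing changes nothing. *)
Lemma forget_derivation (d : tree (rules_alph G')) (g : cfg) : g (start G) = sid0 ->
  @der Sigma G' d (names g [:: start G]) -> derivation (forget d) /\ cval (forget d) = cval d.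
Proof.
move=> g0 d_S; have [dS eS] := forget_correct (start_bignt G) d_S; split=> //.
move: (d_S); rewrite names_start // => d_S'.
have [t et] := cval_derivation d_S'.
rewrite (eS (fun _ => tmap Tm t)); last by rewrite names_start.
by rewrite et [map _ _]/= g0; congr [:: _]; exact: vsubst_nil.
Qed.

(** Both guesses are [sid0] outside the common right-hand side, so they differ inside some link; the
    look-ahead at that child will separate the rules. *)
Lemma cfg_restr_disjoint (x y : new_rule) : x <> y -> old x = old y ->
  exists2 i, i < size (links (old x)) &
    ~~ [forall C, (C \in nth [::] (links (old x)) i) ==> (before x C == before y C)].
Proof.
move=> xy exy.
have [C neC] : exists C, before x C != before y C.
  apply/existsP; apply: contra_notT xy; rewrite negb_exists => /forallP e.
  apply: val_inj; rewrite [val x]surjective_pairing [val y]surjective_pairing.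
  by congr pair => //; apply/ffunP => C; apply/eqP; have := e C; rewrite negbK.
have C_r : C \in nts (rhs (old x)).
  by apply: contraNT neC => C_x; rewrite !before_out // -exy.
move: C_r; rewrite -links_cover => /flattenP[B B_x C_B].
exists (index B (links (old x))); first by rewrite index_mem.
by rewrite nth_index //; apply/negP => /forallP/(_ C); rewrite C_B (negPf neC).
Qed.

(** * From new to old derivations by forgetting the shapes *)

Definition backward : ldtr (rules_alph G') (rules_alph G) :=
  @relabelling (rules_alph G') (rules_alph G) new_rule id old
    (fun _ _ => ranked (@rk (rules_alph G'))) (fun x => size_map _ _)
    (fun _ _ => regular_ranked _) (fun x y xy exy => False_ind _ (xy exy)).

Lemma backward_run d A : der d A -> transduction backward d (forget d).
Proof.
elim/tree_indP: d A => x ds IH A d_A; have := der_ranked d_A => /= /andP[/eqP sz rds].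
move: d_A; rewrite der_node => /andP[_ /(all2_nthP _ (Node x ds) [::])[sz' dl]].
apply: (@relabelling_run _ _ _ _ _ _ _ _ _ _ _ _ (Node x ds) (forget (Node x ds))) => //.
- by rewrite size_map.
- by move=> i lt; apply: (allP rds); exact: mem_nth.
- move=> i lt; rewrite (nth_map (Node x ds)) //.
  by apply: IH; [exact: mem_nth | apply: dl; rewrite -sz'].
Qed.

(** * From old to new derivations by look-ahead *)

Definition combine (r : rules G) (gs : seq cfg) : cfg :=
  [ffun C => if C \in nts (rhs r) then
     nth ([ffun=> sid0] : cfg) gs (find (fun B => C \in B) (links r)) C else sid0].

(** The state of a subtree records the shapes of the nonterminals on the left-hand side of its root
    rule. Only runs matter here; final states are chosen in [forward_la_regular]. *)
Definition shape_bta : bta (rules_alph G) :=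
  @BTA (rules_alph G) cfg (fun r gs => post r (combine r gs)) set0.

(** The state expected at child [i]; the default [sid0] outside the link matches [post_out]. *)
Definition restr (x : new_rule) (i : nat) : cfg :=
  [ffun C => if C \in nth [::] (links (old x)) i then before x C else sid0].

Definition forward_la (x : new_rule) (i : nat) (t : tree (rules_alph G)) : Prop :=
  ranked (@rk (rules_alph G)) t /\ brun shape_bta t = restr x i.

Lemma forward_la_regular x i : regular (forward_la x i).
Proof.
exists (@BTA (rules_alph G) cfg (fun r gs => post r (combine r gs)) [set restr x i]) => t.
(* Runs do not depend on the final states. *)
have -> : brun (@BTA (rules_alph G) cfg (fun r gs => post r (combine r gs)) [set restr x i]) t =
    brun shape_bta t.
  by elim/tree_indP: t => r ts IH /=; congr (post _ (combine _ _)); apply/eq_in_map.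
by rewrite inE; split=> -[rt /eqP].
Qed.

Lemma forward_la_disjoint (x y : new_rule) : x <> y -> old x = old y ->
  exists2 i, i < @rk (rules_alph G) (old x) & disjoint_langs (forward_la x i) (forward_la y i).
Proof.
move=> xy exy; have [i lt ne] := cfg_restr_disjoint xy exy; exists i => // t [[_ ex] [_ ey]].
case/negP: ne; apply/forallP => C; apply/implyP => C_i.
have /ffunP/(_ C) : restr x i = restr y i by rewrite -ex -ey.
by rewrite !ffunE -exy C_i => ->.
Qed.

Definition forward : ldtr (rules_alph G) (rules_alph G') :=
  @relabelling (rules_alph G) (rules_alph G') new_rule old id forward_la
    (fun x => esym (size_map _ _)) forward_la_regular forward_la_disjoint.

Lemma find_block (A : eqType) (ss : seq (seq A)) i c : uniq (flatten ss) -> i < size ss ->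
  c \in nth [::] ss i -> find (fun s => c \in s) ss = i.
Proof.
elim: ss i => //= s ss IH i; rewrite cat_uniq => /and3P[_ /hasPn dis us].
case: i => [|i] lt /= c_i; first by rewrite c_i.
case: ifPn => [c_s|_]; last by rewrite (IH i).
have /dis : c \in flatten ss by apply/flattenP; exists (nth [::] ss i) => //; exact: mem_nth.
by rewrite /= c_s.
Qed.

Lemma choose_seq (A : Type) (a : A) (P : nat -> A -> Prop) n :
  (forall i, i < n -> exists y, P i y) ->
  exists ys, size ys = n /\ forall i, i < n -> P i (nth a ys i).
Proof.
elim: n => [|n IH] ex; first by exists [::].
have [|ys [sz Pys]] := IH; first by move=> i lt; apply: ex; apply: ltnW.
have [y Py] := ex n (leqnn _); exists (rcons ys y); rewrite size_rcons sz; split=> // i.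
rewrite ltnS nth_rcons sz leq_eqVlt => /predU1P[->|lt]; first by rewrite ltnn eqxx.
by rewrite lt; exact: Pys.
Qed.

(** The computed shapes serve as guesses at every node. The first conclusion makes the guess of the
    parent admissible, the second makes its look-ahead succeed, and the third fits the new initial
    nonterminal. *)
Lemma forward_run (d : tree (rules_alph G)) B : der d B ->
  let g : cfg := brun shape_bta d in
  [/\ {in B, forall C, pattern (rk C) (val (g C))},
      forall C, C \notin B -> g C = sid0,
      B = [:: start G] -> g (start G) = sid0 &
      exists d' : tree (rules_alph G'),
        [/\ transduction forward d d', @der Sigma G' d' (names g B) & forget d' = d]].
Proof.
elim/tree_indP: d B => r ds IH B d_B; have := der_ranked d_B => /= /andP[/eqP sz rds].
move: d_B; rewrite der_node => /andP[/eqP-> /(all2_nthP _ (Node r ds) [::])[sz' dl]].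
set gs := map _ ds; set g := combine r gs.
(* Links are disjoint, so [combine] consults exactly the child that derives the link containing
   [C]. *)
have gE i C : i < size ds -> C \in nth [::] (links (r : rules G)) i ->
    g C = brun shape_bta (nth (Node r ds) ds i) C.
  move=> lt C_i.
  have C_l : C \in flatten (links (r : rules G)).
    apply/flattenP; exists (nth [::] (links (r : rules G)) i) => //.
    by apply: mem_nth; rewrite -sz'.
  rewrite ffunE -links_cover C_l (find_block (links_disj (r : rules G)) _ C_i) -?sz' //.
  by rewrite (nth_map (Node r ds)).
have lt_links i : i < size ds -> i < size (links (r : rules G)) by rewrite sz'.
have {}IH i (lt : i < size ds) := IH _ (mem_nth (Node r ds) lt) _ (dl i (lt_links i lt)).
have ok : okrule (r, g).
  apply/forallP => C /=; case: ifPn => [|C_r]; last by rewrite ffunE (negPf C_r).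
  rewrite -links_cover => /flattenP[B' /(nthP [::])[i lt <-] C_i].
  by rewrite -sz' in lt; rewrite (gE i) //; have [pat _ _ _] := IH i lt; exact: pat.
pose x : new_rule := exist _ (r, g) ok.
split; [exact: post_pattern ok | exact: post_out | by move/esym/(@lhs_start_after x) |].
have same i : i < size ds -> {in nth [::] (links (r : rules G)) i,
    g =1 (brun shape_bta (nth (Node r ds) ds i) : cfg)}.
  by move=> lt C C_i; exact: gE.
have [ds' [szds' run]] := choose_seq (Node x [::] : tree (rules_alph G'))
  (fun i lt => let: And4 _ _ _ ex := IH i lt in ex).
exists (Node x ds'); split.
- apply: (@relabelling_run (rules_alph G) (rules_alph G') new_rule old id forward_la _
      forward_la_regular forward_la_disjoint x ds ds' (Node r ds) (Node x ds')) => //.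
  + move=> i lt; split; first by apply: (allP rds); exact: mem_nth.
    apply/ffunP => C; rewrite [RHS]ffunE; case: ifPn => C_i; first by rewrite -(gE i).
    by have [_ out _ _] := IH i lt; exact: out.
  + by move=> i lt; have [run_i _ _] := run i lt; rewrite (set_nth_default (Node x [::])) ?szds'.
- rewrite der_node eqxx /=; apply/(all2_nthP _ (Node x [::]) [::]).
  rewrite size_map szds' sz'; split=> // i lt; rewrite (nth_map [::]) //.
  have lt' : i < size ds by rewrite sz'.
  by have [_ der_i _] := run i lt'; rewrite (eq_in_names (same i lt')).
- rewrite /= ; congr Node; apply: (@eq_from_nth _ (Node r ds)); rewrite size_map // szds' => i lt.
  rewrite (nth_map (Node x [::])) ?szds' //; have [_ _ e] := run i lt.
  exact: e.
Qed.

Lemma monadic_form_equivalent : ldtr_equivalent G G'.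
Proof.
split.
  exists forward => d der_d; have := forward_run der_d.
  set g : cfg := brun shape_bta d => -[_ _ /(_ erefl) g0 [d' [run der_d' e]]].
  have [_ ev] := forget_derivation g0 der_d'.
  have [t et] := cval_derivation der_d.
  exists d'; split=> //; first by rewrite /derivation -(names_start g0).
  exists t; split; first exact: cval_yields.
  apply: cval_yields; first by rewrite /derivation -(names_start g0).
  by rewrite -ev e.
exists backward => d der_d.
pose g : cfg := [ffun=> sid0].
have g0 : g (start G) = sid0 by rewrite ffunE.
have [der_f ev] := @forget_derivation d g g0 ltac:(by rewrite names_start).
exists (forget d); split=> //; first exact: backward_run der_d.
have [t et] := cval_derivation der_d; exists t; split; first exact: cval_yields.
by apply: cval_yields => //; rewrite ev.
Qed.

End Construction.

Theorem theorem61 (Sigma : ralph) (G : mcftg Sigma) (theta_ge2 : 2 <= width G) :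
  exists G' : mcftg Sigma,
    [/\ ldtr_equivalent G G',
        monadic G',
        multiplicity G' <=
          multiplicity G * #|Sigma| * mr Sigma ^ 2 * (2 * width G - 1)
      & forall Delta : {set Sigma},
          (forall a, a \in Delta -> rk a = 0) ->
          lexicalized G Delta -> lexicalized G' Delta].
Proof.
exists (monadic_form theta_ge2); split.
- exact: monadic_form_equivalent.
- exact: monadic_form_monadic.
(* [piece_bound] contributes [mr Sigma] once; the remaining factors [#|Sigma|] and [mr Sigma] are at
   least 1, the former because an empty alphabet would have maximal rank 0. *)
- apply: leq_trans (monadic_form_multiplicity theta_ge2) _.
  have m_gt0 := mr_gt0 G.
  have card_gt0 : 0 < #|Sigma|.
    apply: contraTltn m_gt0; rewrite leqn0 => /eqP card0.
    rewrite -leqNgt; apply/bigmax_leqP => a _.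
    by have := fintype0 a card0.
  rewrite /piece_bound -!mulnA leq_mul2l; apply/orP; right.
  rewrite mulnC; apply: leq_trans (leq_pmull _ card_gt0).
  by rewrite leq_mul2l leq_pmull ?orbT.
- exact: monadic_form_lexicalized.
Qed.
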